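(* Let $1\leq p,q<\infty$, $\alpha>-1$, $\mu>0$ and $s>\max\big(0,\frac{\alpha+1}{p}-1\big)$. Assume that $\mu$ is not an even integer. If $$|f|^{\mu}\in B_{p,q}^{s}(\mathbb{R},|\cdot|^{\alpha})\quad\text{for every } f\in B_{p,q}^{s}(\mathbb{R},|\cdot|^{\alpha}),$$ that is, if $G_{\mu}(B_{p,q}^{s}(\mathbb{R},|\cdot|^{\alpha}))\subset B_{p,q}^{s}(\mathbb{R},|\cdot|^{\alpha})$ where $G_\mu(f)=|f|^\mu$, then $$s<\mu+\frac{1+\alpha}{p}.$$
   Context: Weighted Lebesgue spaces: for $\alpha\in\mathbb{R}$ and $0<p<\infty$, $L^{p}(\mathbb{R}^{n},|\cdot|^{\alpha})$ is the set of measurable functions $f$ with $\|f\|_{L^{p}(\mathbb{R}^{n},|\cdot|^{\alpha})}=\big(\int_{\mathbb{R}^{n}}|f(x)|^{p}|x|^{\alpha}dx\big)^{1/p}<\infty$. Fourier transform: $\mathcal{F}f(\xi)=(2\pi)^{-n/2}\int_{\mathbb{R}^n}e^{-ix\cdot\xi}f(x)\,dx$, extended to $\mathcal{S}'(\mathbb{R}^n)$, with inverse $\mathcal{F}^{-1}$. Smooth dyadic resolution of unity: let $\psi\in\mathcal{S}(\mathbb{R}^{n})$ with $\psi(x)=1$ for $|x|\leq1$ and $\psi(x)=0$ for $|x|\geq\frac32$. Put $\varphi_0=\psi$, $\varphi_1(x)=\psi(x/2)-\psi(x)$, $\varphi_j(x)=\varphi_1(2^{-j+1}x)$ for $j=2,3,\dots$.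 Besov spaces with power weights: for $\alpha,s\in\mathbb{R}$, $0<p<\infty$, $0<q\leq\infty$, $B_{p,q}^{s}(\mathbb{R}^{n},|\cdot|^{\alpha})$ is the set of all $f\in\mathcal{S}'(\mathbb{R}^{n})$ with $$\|f\|_{B_{p,q}^{s}(\mathbb{R}^{n},|\cdot|^{\alpha})}=\Big(\sum_{j=0}^{\infty}2^{jsq}\|\mathcal{F}^{-1}\varphi_j*f\|_{L^{p}(\mathbb{R}^{n},|\cdot|^{\alpha})}^{q}\Big)^{1/q}<\infty$$ (supremum over $j$ if $q=\infty$). For $\alpha>-n$ the space does not depend on the choice of resolution of unity, up to equivalent quasi-norms. Here $n=1$. Under the stated condition on $s$, all elements of the space are regular distributions (identified with functions in $L^1_{loc}$), so $|f|^\mu$ is understood as a pointwise a.e. defined function, and $|f|^\mu\in B_{p,q}^s$ means that it defines a regular tempered distribution belonging to this space. *)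

(* Defs.v *)
From HB Require Import structures.
From mathcomp Require Import all_boot all_order all_algebra.
From mathcomp Require Import complex.
From mathcomp Require Import all_classical all_reals all_analysis.

Set Implicit Arguments.
Unset Strict Implicit.
Unset Printing Implicit Defensive.

Import Order.TTheory GRing.Theory Num.Theory.
Import numFieldNormedType.Exports.

Local Open Scope classical_set_scope.
Local Open Scope ring_scope.
Local Open Scope complex_scope.

(* Derivatives and integrals of complex-valued functions of a real variable
   are taken componentwise; [Normc.normc z : R] is the modulus of [z : R[i]],
   as opposed to [`|z| : R[i]]. *)

Definition cderiv {R : realType} (l : nat) (f : R -> R[i]) (x : R) : R[i] :=
  derive1n l (fun t => complex.Re (f t)) x
  +i* derive1n l (fun t => complex.Im (f t)) x.

Definition csmooth {R : realType} (f : R -> R[i]) : Prop :=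
  forall (l : nat) (x : R),
    derivable (derive1n l (fun t => complex.Re (f t))) x 1 /\
    derivable (derive1n l (fun t => complex.Im (f t))) x 1.

Definition cintegral {R : realType} (f : R -> R[i]) : R[i] :=
  (\int[lebesgue_measure]_x complex.Re (f x))
  +i* (\int[lebesgue_measure]_x complex.Im (f x)).

Definition clocally_integrable {R : realType} (f : R -> R[i]) : Prop :=
  locally_integrable setT (fun x => complex.Re (f x)) /\
  locally_integrable setT (fun x => complex.Im (f x)).

Definition schwartz {R : realType} (f : R -> R[i]) : Prop :=
  csmooth f /\
  forall k l : nat, exists M : R, forall x : R,
    `|x| ^+ k * Normc.normc (cderiv l f x) <= M.

(* The supremum of the real set is meaningful (the set is bounded) for
   Schwartz functions, the only ones it is used for. *)
Definition schwartz_seminorm {R : realType} (k l : nat) (f : R -> R[i]) : R :=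
  sup (range (fun x : R => `|x| ^+ k * Normc.normc (cderiv l f x))).

Definition test_function {R : realType} (f : R -> R[i]) : Prop :=
  csmooth f /\ exists A : R, forall x : R, A < `|x| -> f x = 0.

(* A tempered distribution is a continuous linear functional on the Schwartz
   space; its values at functions that are not Schwartz are irrelevant. *)
Definition tempered {R : realType} (u : (R -> R[i]) -> R[i]) : Prop :=
  (forall (a : R[i]) (f g : R -> R[i]), schwartz f -> schwartz g ->
     u (fun x => a * f x + g x) = a * u f + u g) /\
  exists (N : nat) (K : R), forall f : R -> R[i], schwartz f ->
    Normc.normc (u f) <=
      K * \sum_(k < N) \sum_(l < N) schwartz_seminorm k l f.

(* [u] is the regular distribution given by [f] in L^1_loc; test functions
   being dense in the Schwartz space, this determines a tempered [u]. *)
Definition regular_distribution {R : realType}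
    (u : (R -> R[i]) -> R[i]) (f : R -> R[i]) : Prop :=
  clocally_integrable f /\
  forall phi : R -> R[i], test_function phi ->
    u phi = cintegral (fun x => f x * phi x).

Definition inv_fourier {R : realType} (g : R -> R[i]) (x : R) : R[i] :=
  ((Num.sqrt (2 * pi))^-1)%:C *
  cintegral (fun xi => (cos (x * xi) +i* sin (x * xi)) * g xi).

Definition convolution {R : realType} (g : R -> R[i])
    (u : (R -> R[i]) -> R[i]) (x : R) : R[i] :=
  u (fun y => g (x - y)).

Definition resolution_generator {R : realType} (psi : R -> R[i]) : Prop :=
  [/\ schwartz psi,
      forall x : R, `|x| <= 1 -> psi x = 1 &
      forall x : R, 3 / 2 <= `|x| -> psi x = 0].

Definition dyadic {R : realType} (psi : R -> R[i]) (j : nat) (x : R) : R[i] :=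
  if j is i.+1 then psi (x / 2 ^+ i / 2) - psi (x / 2 ^+ i) else psi x.

Definition weighted_Lp_norm {R : realType} (p alpha : R) (f : R -> R[i])
    : \bar R :=
  ((\int[lebesgue_measure]_x
      (Normc.normc (f x) `^ p * `|x| `^ alpha)%:E) `^ p^-1)%E.

(* Only for [0 < q < +oo]. *)
Definition besov_norm {R : realType} (psi : R -> R[i]) (s p q alpha : R)
    (u : (R -> R[i]) -> R[i]) : \bar R :=
  ((\sum_(0 <= j <oo)
      (2 `^ (j%:R * s * q))%:E *
      weighted_Lp_norm p alpha (convolution (inv_fourier (dyadic psi j)) u)
        `^ q) `^ q^-1)%E.

Definition besov {R : realType} (psi : R -> R[i]) (s p q alpha : R)
    (u : (R -> R[i]) -> R[i]) : Prop :=
  tempered u /\ (besov_norm psi s p q alpha u < +oo)%E.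

Definition abs_power {R : realType} (mu : R) (f : R -> R[i]) (x : R) : R[i] :=
  (Normc.normc (f x) `^ mu)%:C.

(* Main.v *)
Require Import Defs.
From HB Require Import structures.
From mathcomp Require Import all_boot all_order all_algebra.
From mathcomp Require Import complex.
From mathcomp Require Import all_classical all_reals all_analysis.
From mathcomp Require Import measurable_realfun.
From mathcomp Require Import ring lra.

Set Implicit Arguments.
Unset Strict Implicit.
Unset Printing Implicit Defensive.

Import Order.TTheory GRing.Theory Num.Theory.
Import numFieldNormedType.Exports.

Local Open Scope classical_set_scope.
Local Open Scope ring_scope.

(* Suppose [s >= mu + (1 + alpha) / p], and let [f] be an odd band-limited
   Schwartz function with [f' 0 > 0]; it lies in the space, since the kernels
   [K_j] of index [j >= 2] annihilate it.  As [K_{i+1} x = 2^i k (2^i x)] with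
   [k x = 2 P (2 x) - P x] and [P] the real part of F^-1 psi, the
   functions [z -> 2^(i mu) (K_{i+1} * |f|^mu) (2^-i z)] converge pointwise to
   [f'(0)^mu |.|^mu * k], while their weighted L^p norms are at most
   [2^(i (mu + (1 + alpha) / p)) || K_{i+1} * |f|^mu ||], which tends to [0] by the
   choice of [s].  By Fatou's lemma, [|.|^mu * k = 0], that is, the function
   [h = |.|^mu * P] satisfies [h (2 z) = 2^mu (h z)].  Rescaling the convolution
   towards an approximate identity gives [h z = |z|^mu * \int P] with
   [\int P <> 0].  But [h] is smooth, and [|.|^mu] is smooth only if [mu] is an
   even integer. *)

(** Since [f] is smooth, [|f|^mu] can lose regularity only at zeros of [f]; the blow-up isolates the
    zero at the origin. The distributional Fourier transform of [|.|^mu] is never formed: each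
    dyadic piece of index at least [1] is a difference of two dilates of [psi], so annihilation by
    one such piece is already a scaling relation. That relation concerns the single ratio [2], which
    is enough because the points [2^-j z] accumulate at [0], where smoothness is exploited.

    The negated conclusion includes equality in the bound on [s]. There a bound on the rescaled
    norms would give no contradiction; what decides is that the terms of a convergent [l^q] sum,
    with [q] finite, tend to zero.

    As [psi] may be complex-valued, so may the kernels. The limit is taken for the real part of the
    convolution, which the modulus dominates, and all transforms become real sine and cosine
    integrals. That [\int P] is nonzero is Fourier inversion at [0], where [psi] is [1]. The
    distribution representing [|f|^mu] is an abstract functional known on test functions, so its
    values at Schwartz kernels have to be recovered by continuity. *)

(** * Affine change of variables for the Lebesgue integral on the line *)

Section affine_substitution.
Context {R : realType}.
Local Notation leb := (@lebesgue_measure R).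

Lemma measurable_affine (c d : R) :
  measurable_fun [set: R] (fun x : R => c * x + d).
Proof. by apply: measurable_funD => //; exact: measurable_funM. Qed.

(** Half-open intervals suffice because they determine the Lebesgue measure. For [c < 0] the
    preimage is closed at the other end, which leaves its length unchanged. *)
Lemma preimage_affine_itvoc (c d a b : R) : c != 0 ->
  (`|c|%:E * leb ((fun x => (c * x + d)%R) @^-1` `]a, b]%classic) = leb `]a, b]%classic)%E.
Proof.
move=> c0; rewrite lebesgue_measure_itv/= lte_fin.
have [cp|cn|/eqP] := ltgtP 0 c; last by rewrite eq_sym (negbTE c0).
- have -> : (fun x => (c * x + d)%R) @^-1` `]a, b]%classic = `](a - d) / c, (b - d) / c]%classic.
    apply/seteqP; split => x /=; rewrite !in_itv/= ltr_pdivrMr//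
      ler_pdivlMr// lerBrDr ltrBlDr mulrC//.
  rewrite lebesgue_measure_itv/= lte_fin ltr_pM2r ?invr_gt0// ltrD2r.
  case: ifP => ab; rewrite ?mule0// -!EFinB -EFinM; congr EFin.
  by rewrite gtr0_norm//; field.
- have -> : (fun x => (c * x + d)%R) @^-1` `]a, b]%classic = `[(b - d) / c, (a - d) / c[%classic.
    apply/seteqP; split => x /=; rewrite !in_itv/= ltr_ndivlMr//
      ler_ndivrMr// lerBrDr ltrBlDr mulrC// andbC//.
  rewrite lebesgue_measure_itv/= lte_fin ltr_nM2r ?invr_lt0// ltrD2r.
  case: ifP => ab; rewrite ?mule0// -!EFinB -EFinM; congr EFin.
  by rewrite ltr0_norm//; field.
Qed.

(** The pushforward under the affine map, scaled by [|c|], agrees with the Lebesgue measure on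
    half-open intervals, so uniqueness of the latter applies. *)
Lemma lebesgue_measure_affine (c d : R) (A : set R) : c != 0 -> measurable A ->
  leb A = (`|c|%:E * leb ((fun x => (c * x + d)%R) @^-1` A))%E.
Proof.
move=> c0 mA.
pose phi_mixin := isMeasurableFun.Build _ _ (measurableTypeR R) (measurableTypeR R) _ (measurable_affine c d).
pose phi_pack : {mfun (measurableTypeR R) >-> (measurableTypeR R)} :=
  HB.pack (fun x : R => c * x + d) phi_mixin.
rewrite (@lebesgue_measure_unique R
  (mscale (NngNum (normr_ge0 c)) (pushforward leb phi_pack))) //.
move=> X [[a b] _ /= <-].
by rewrite -(preimage_affine_itvoc d a b c0).
Qed.

Lemma ge0_integral_affine (c d : R) (f : R -> \bar R) : c != 0 ->
  measurable_fun setT f -> (forall x, 0 <= f x)%E ->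
  (\int[leb]_x f x = `|c|%:E * \int[leb]_x f (c * x + d)%R)%E.
Proof.
move=> c0 mf f0.
have mphi : measurable_fun [set: measurableTypeR R]
    (fun x => (c * x + d)%R : measurableTypeR R).
  exact: measurable_affine.
have := ge0_integral_pushforward mphi leb measurableT mf (fun x _ => f0 x).
rewrite preimage_setT => <-.
rewrite -(ge0_integral_mscale _ _ (NngNum (normr_ge0 c)))//.
apply: eq_measure_integral => A mA _.
exact: (lebesgue_measure_affine d c0 mA).
Qed.

Lemma integrable_affine (c d : R) (f : R -> R) : c != 0 ->
  leb.-integrable setT (EFin \o f) ->
  leb.-integrable setT (EFin \o (fun x => f (c * x + d))).
Proof.
move=> c0 /integrableP[mf fi]; apply/integrableP; split.
  apply/measurable_EFinP; apply: (measurableT_comp (f := f)).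
    exact/measurable_EFinP.
  exact: measurable_affine.
have := fun d => @ge0_integral_affine c d (fun x => `|(f x)%:E|)%E c0.
have mn : measurable_fun setT (fun x => `|(f x)%:E|%E).
  exact: (measurableT_comp (@abse_measurable R setT) mf).
move=> /(_ d mn (fun x => abse_ge0 _)) e; move: fi; rewrite /= e.
rewrite muleC; case: (integral _ _ _) => [r| |] //=.
  by move=> _; rewrite ltry.
by rewrite gt0_mulye// lte_fin normr_gt0.
Qed.

Lemma Rintegral_affine (c d : R) (f : R -> R) : c != 0 ->
  leb.-integrable setT (EFin \o f) ->
  (\int[leb]_x f x = `|c| * \int[leb]_x f (c * x + d))%R.
Proof.
move=> c0 fi; have fi' := integrable_affine d c0 fi.
have mf := measurable_int _ fi.
have mf' := measurable_int _ fi'.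
rewrite /Rintegral integralE [in RHS]integralE.
rewrite (ge0_integral_affine d c0 (f := (EFin \o f)^\+%E)); last 2 first.
- exact: measurable_funepos.
- by move=> x; exact: funepos_ge0.
rewrite (ge0_integral_affine d c0 (f := (EFin \o f)^\-%E)); last 2 first.
- exact: measurable_funeneg.
- by move=> x; exact: funeneg_ge0.
have ep : ((EFin \o (fun x => f (c * x + d)%R))^\+ = (EFin \o f)^\+ \o (fun x => (c * x + d)%R))%E.
  exact: (funepos_comp (EFin \o f) (fun x => (c * x + d)%R)).
have en : ((EFin \o (fun x => f (c * x + d)%R))^\- = (EFin \o f)^\- \o (fun x => (c * x + d)%R))%E.
  exact: (funeneg_comp (EFin \o f) (fun x => (c * x + d)%R)).
have := integrable_funepos measurableT fi'; rewrite ep => ip.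
have := integrable_funeneg measurableT fi'; rewrite en => im.
have := integrable_fin_num measurableT ip.
have := integrable_fin_num measurableT im.
rewrite /= => imf ipf.
rewrite -muleBr//; first by rewrite fineM// fin_numB ipf.
exact: fin_num_adde_defr.
Qed.

End affine_substitution.

(** * Real-valued integrals: domination, Fubini, differentiation under the integral sign *)

Section integral_toolkit.
Context {R : realType}.
Local Notation leb := (@lebesgue_measure R).
Implicit Types f g h : R -> R.

Lemma ctsM f g : continuous f -> continuous g -> continuous (fun x => f x * g x).
Proof. by move=> cf cg x; apply: cvgM; [exact: cf|exact: cg]. Qed.

Lemma ctsD f g : continuous f -> continuous g -> continuous (fun x => f x + g x).
Proof. by move=> cf cg x; apply: cvgD; [exact: cf|exact: cg]. Qed.

Lemma ctsB f g : continuous f -> continuous g -> continuous (fun x => f x - g x).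
Proof. by move=> cf cg x; apply: cvgB; [exact: cf|exact: cg]. Qed.

Lemma ctsN f : continuous f -> continuous (fun x => - f x).
Proof. by move=> cf x; apply: cvgN; exact: cf. Qed.

Lemma cts_cst (c : R) : continuous (fun _ : R => c).
Proof. by move=> x; exact: cvg_cst. Qed.

Lemma cts_id : continuous (fun x : R => x).
Proof. by move=> x; exact: cvg_id. Qed.

Lemma cts_comp f g : continuous f -> continuous g -> continuous (fun x => f (g x)).
Proof. by move=> cf cg x; apply: continuous_comp; [exact: cg|exact: cf]. Qed.

Lemma cts_norm f : continuous f -> continuous (fun x => `|f x|).
Proof. by move=> cf; apply: cts_comp => //; exact: norm_continuous. Qed.

Lemma cts_affine (c d : R) : continuous (fun x : R => c * x + d).
Proof.
by apply: ctsD (@cts_cst d); apply: ctsM (@cts_cst c) _; exact: cts_id.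
Qed.

Definition L1 f := leb.-integrable setT (EFin \o f).

Lemma L1_measurable f : L1 f -> measurable_fun setT f.
Proof. by move=> /measurable_int /measurable_EFinP. Qed.

Lemma L1_le f g : measurable_fun setT f -> (forall x, `|f x| <= g x) -> L1 g -> L1 f.
Proof.
move=> mf fg; apply: le_integrable => //; first exact/measurable_EFinP.
by move=> x _ /=; rewrite lee_fin (le_trans (fg x))// ler_norm.
Qed.

Lemma L1_norm f : L1 f -> L1 (fun x => `|f x|).
Proof. by move=> fi; exact: (integrable_abse fi). Qed.

Lemma L1D f g : L1 f -> L1 g -> L1 (fun x => f x + g x).
Proof. by move=> fi gi; exact: (integrableD measurableT fi gi). Qed.

Lemma L1B f g : L1 f -> L1 g -> L1 (fun x => f x - g x).
Proof. by move=> fi gi; exact: (integrableB measurableT fi gi). Qed.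

Lemma L1Z c f : L1 f -> L1 (fun x => c * f x).
Proof. by move=> fi; exact: (integrableZl measurableT c fi). Qed.

Lemma L1_dominated (F : nat -> R -> R) f g :
  (forall n, measurable_fun setT (F n)) -> L1 g ->
  (forall n x, `|F n x| <= g x) -> (forall x, F n x @[n --> \oo] --> f x) ->
  L1 f /\ \int[leb]_x F n x @[n --> \oo] --> \int[leb]_x f x.
Proof.
move=> mF gi Fg Ff.
have mf : measurable_fun setT f.
  by apply: (measurable_fun_cvg (h := F)) => // x _; exact: Ff.
have [||||fi _ cv] := @dominated_convergence _ _ _ leb setT measurableT
    (fun n => EFin \o F n) (EFin \o f) (EFin \o g) _ _ _ gi.
- by move=> n; apply/measurable_EFinP; exact: mF.
- exact/measurable_EFinP.
- by apply: aeW => x _; apply: cvg_EFin; [exact: nearW|exact: Ff].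
- by apply: aeW => x n _; rewrite lee_fin.
split => //; rewrite /Rintegral; apply: fine_cvg.
by rewrite fineK// integrable_fin_num.
Qed.

(** The standard integrable majorant: functions of rapid decay are compared with it throughout. *)
Lemma L1_oneDsqrV : L1 (fun x => (1 + x ^+ 2)^-1).
Proof.
have p x : 0 <= (1 + x ^+ 2)^-1 :> R.
  by rewrite invr_ge0 addr_ge0// sqr_ge0.
have c : continuous (fun x : R => (1 + x ^+ 2)^-1) := @continuous_oneDsqrV R.
apply/integrableP; split.
  by apply/measurable_EFinP; exact: continuous_measurable_fun.
under eq_integral do rewrite /= ger0_norm//.
rewrite ge0_symfun_integralT//; last by move=> x /=; rewrite sqrrN.
have := @integral0y_oneDsqr R; rewrite set_itvcy => ->.
by rewrite -EFinM ltry.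
Qed.

Lemma L1_decay f M : measurable_fun setT f ->
  (forall x, (1 + x ^+ 2) * `|f x| <= M) -> L1 f.
Proof.
move=> mf fM; apply: L1_le (L1Z M L1_oneDsqrV) => // x.
rewrite ler_pdivlMr; last by rewrite ltr_pwDl// sqr_ge0.
by rewrite mulrC.
Qed.

Lemma le_RintegralT f g : L1 f -> L1 g -> (forall x, f x <= g x) ->
  \int[leb]_x f x <= \int[leb]_x g x.
Proof. by move=> fi gi fg; apply: le_Rintegral. Qed.

Lemma L1_norm_le f g : L1 g -> measurable_fun setT f ->
  (forall x, `|f x| <= g x) -> `|\int[leb]_x f x| <= \int[leb]_x g x.
Proof.
move=> gi mf fg; have fi := L1_le mf fg gi.
apply: le_trans (le_normr_Rintegral measurableT fi) _.
by apply: le_RintegralT => //; exact: L1_norm.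
Qed.

Lemma RintegralTD f g : L1 f -> L1 g ->
  \int[leb]_x (f x + g x) = \int[leb]_x f x + \int[leb]_x g x.
Proof. by move=> fi gi; rewrite RintegralD. Qed.

Lemma RintegralTB f g : L1 f -> L1 g ->
  \int[leb]_x (f x - g x) = \int[leb]_x f x - \int[leb]_x g x.
Proof. by move=> fi gi; rewrite RintegralB. Qed.

Lemma RintegralTZ c f : L1 f -> \int[leb]_x (c * f x) = c * \int[leb]_x f x.
Proof. by move=> fi; rewrite RintegralZl. Qed.

Lemma RintegralT_odd f : L1 f -> (forall x, f (- x) = - f x) ->
  \int[leb]_x f x = 0.
Proof.
move=> fi fo; have n1 : (-1 : R) != 0 by rewrite oppr_eq0 oner_eq0.
have := Rintegral_affine 0 n1 fi.
under [X in _ = _ * X]eq_Rintegral => x _.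
  have -> : f (-1 * x + 0) = (-1) * f x by rewrite addr0 mulN1r fo mulN1r.
  over.
rewrite RintegralTZ// normrN1 => /eqP; rewrite mul1r mulN1r -addr_eq0.
by rewrite -mulr2n -mulr_natl mulf_eq0 pnatr_eq0 /= => /eqP.
Qed.

Lemma Rintegral_sub_var f (x : R) : L1 f ->
  \int[leb]_y f (x - y) = \int[leb]_y f y.
Proof.
move=> fi; have n1 : (-1 : R) != 0 by rewrite oppr_eq0 oner_eq0.
rewrite (Rintegral_affine x n1 fi) normrN1 mul1r.
by apply: eq_Rintegral => y _; rewrite mulN1r addrC.
Qed.

Lemma L1_sub_var f (x : R) : L1 f -> L1 (fun y => f (x - y)).
Proof.
move=> fi; have n1 : (-1 : R) != 0 by rewrite oppr_eq0 oner_eq0.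
have := integrable_affine x n1 fi; rewrite /L1.
by under eq_fun do rewrite mulN1r addrC.
Qed.

(** The product majorant bounds the iterated integral of [|f|] by a product of two finite integrals,
    which gives integrability on the plane. All inner integrals are then finite, so [fine] loses
    nothing. *)
Lemma Rintegral_Fubini (f : R -> R -> R) g h :
  measurable_fun setT (fun z : R * R => f z.1 z.2) -> L1 g -> L1 h ->
  (forall x y, `|f x y| <= `|g x| * `|h y|) ->
  \int[leb]_x (\int[leb]_y f x y) = \int[leb]_y (\int[leb]_x f x y).
Proof.
move=> mf gi hi fgh.
have mf1 x : measurable_fun setT (f x).
  by have := measurableT_comp mf (pair1_measurable x).
have mf2 y : measurable_fun setT (f^~ y).
  by have := measurableT_comp mf (pair2_measurable y).
have f1 x : L1 (f x).
  apply: (L1_le (mf1 x) (fgh x)); exact/L1Z/L1_norm.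
have f2 y : L1 (f^~ y).
  apply: (L1_le (mf2 y) (g := fun x => `|h y| * `|g x|)); last exact/L1Z/L1_norm.
  by move=> x; rewrite mulrC.
have fi : (leb \x leb)%E.-integrable setT (fun z : R * R => (f z.1 z.2)%:E).
  apply/integrable12ltyP; first exact/measurable_EFinP.
  apply: (@le_lt_trans _ _ (\int[leb]_x \int[leb]_y (`|g x| * `|h y|)%:E)%E).
    apply: ge0_le_integral => //.
    - by move=> x _; apply: integral_ge0.
    - apply: (@measurable_fun_fubini_tonelli_F _ _ _ _ _ leb
        (fun z : R * R => `|(f z.1 z.2)%:E|%E)) => //.
      by apply: measurableT_comp => //; exact/measurable_EFinP.
    - apply: (@measurable_fun_fubini_tonelli_F _ _ _ _ _ leb
        (fun z : R * R => (`|g z.1| * `|h z.2|)%:E)%E) => //.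
      apply/measurable_EFinP; apply: measurable_funM.
      + apply: measurableT_comp => //.
        by apply: (measurableT_comp (L1_measurable gi)).
      + apply: measurableT_comp => //.
        by apply: (measurableT_comp (L1_measurable hi)).
    move=> x _; apply: ge0_le_integral => //.
    - apply: (measurableT_comp (@abse_measurable R setT)).
      by apply/measurable_EFinP; exact: mf1.
    - by apply/measurable_EFinP; exact: L1_measurable (L1Z _ (L1_norm hi)).
    - by move=> y _; rewrite lee_fin.
  have hn := L1_norm hi.
  under eq_integral => x _.
    rewrite (_ : \int[leb]_y _ = (\int[leb]_y `|h y|)%:E * (`|g x|)%:E)%E; last first.
      under eq_integral do rewrite EFinM.
      rewrite integralZl//= muleC; congr (_ * _)%E.
      by rewrite fineK//; exact: integrable_fin_num hn.
    over.
  rewrite integralZl//=; last exact: L1_norm.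
  have := integrable_fin_num measurableT (L1_norm gi).
  by rewrite fin_numElt => /andP[_ ?]; rewrite lte_mul_pinfty// lee_fin Rintegral_ge0.
have := Fubini fi.
rewrite /Rintegral /= => e.
congr fine; move: e.
under eq_integral.
  move=> x _; rewrite (_ : \int[leb]_y (f x y)%:E = (fine (\int[leb]_y (f x y)%:E))%:E)%E; last first.
    by rewrite fineK//; exact: integrable_fin_num (f1 x).
  over.
move=> ->; apply: eq_integral => y _.
by rewrite fineK//; exact: integrable_fin_num (f2 y).
Qed.

Lemma continuous_Rintegral (f : R -> R -> R) g :
  (forall x, measurable_fun setT (f x)) -> (forall y, continuous (f^~ y)) ->
  L1 g -> (forall x y, `|f x y| <= g y) ->
  continuous (fun x => \int[leb]_y f x y).
Proof.
move=> mf cf gi fg x.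
have := @continuity_under_integral R _ _ leb f setT measurableT (x - 1) (x + 1).
move=> /(_ _ _ g gi _ x); apply.
- by move=> z _; apply: L1_le gi.
- by apply: aeW => y _ z _; exact: cf.
- by move=> z _; apply: aeW => y _.
- by rewrite inE/= in_itv/=; apply/andP; split; lra.
Qed.

(** The majorant is asked for only within distance [1] of [x] and may depend on [x]: for translates
    of a kernel integrated against a growing function, only such a local majorant is at hand. *)
Lemma is_derive_Rintegral (f f' : R -> R -> R) (G : R -> R -> R) (x : R) :
  (forall x, L1 (f x)) -> (forall x y : R, is_derive x (1 : R) (fun t : R => f t y) (f' x y)) ->
  L1 (G x) -> (forall z y, x - 1 < z < x + 1 -> `|f' z y| <= G x y) ->
  is_derive x (1 : R) (fun x => \int[leb]_y f x y) (\int[leb]_y f' x y).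
Proof.
move=> fi df gi fg.
have Ix : `]x - 1, x + 1[%classic x by rewrite /= in_itv/=; apply/andP; split; lra.
have G0 y : 0 <= G x y.
  by apply: le_trans (fg x y _) => //; apply/andP; split; lra.
have dE z y : partial1of2 f z y = f' z y.
  by rewrite partial1of2E; apply: derive_val.
have df1 z y : `]x - 1, x + 1[%classic z -> setT y -> derivable (f^~ y) z 1.
  by move=> _ _; exact: ex_derive.
have ub z y : `]x - 1, x + 1[%classic z -> setT y -> `|partial1of2 f z y| <= G x y.
  by rewrite /= in_itv/= dE => zx _; exact: fg.
apply: DeriveDef.
  exact: (derivable_under_integral measurableT Ix (fun z _ => fi z) df1 G0 gi ub).
rewrite -derive1E (differentiation_under_integral measurableT Ix (fun z _ => fi z) df1 G0 gi ub).
by apply: eq_Rintegral => y _; exact: dE.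
Qed.

Lemma is_derive_continuous f (x d : R) : is_derive x (1 : R) f d -> {for x, continuous f}.
Proof.
move=> df; have /derivable1_diffP : derivable f x 1 by exact: ex_derive.
exact: differentiable_continuous.
Qed.

Lemma is_derive_mulr (a x : R) : is_derive x (1 : R) (fun t : R => t * a) a.
Proof. by apply: is_derive_eq; rewrite scaler0 add0r scaler1. Qed.

Lemma is_derive_mull (a x : R) : is_derive x (1 : R) (fun t : R => a * t) a.
Proof. by under eq_fun do rewrite mulrC; exact: is_derive_mulr. Qed.

Lemma is_derive_sin_mulr (a x : R) :
  is_derive x (1 : R) (fun t : R => sin (t * a)) (cos (x * a) * a).
Proof.
exact: (is_derive1_comp (f := sin) (is_derive_sin _) (is_derive_mulr a x)).
Qed.

Lemma is_derive_cos_mulr (a x : R) :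
  is_derive x (1 : R) (fun t : R => cos (t * a)) (- sin (x * a) * a).
Proof.
exact: (is_derive1_comp (f := cos) (is_derive_cos _) (is_derive_mulr a x)).
Qed.

(** The fundamental theorem on a half-line is applied to nonnegative integrands, whereas [cos]
    changes sign. Hence [1 + cos] is integrated first, and the integral of [expR (- |x|)] is
    subtracted at the end. *)
Lemma exp_abs_cos (xi : R) :
  L1 (fun x => expR (- `|x|)) /\
  \int[leb]_x (cos (x * xi) * expR (- `|x|)) = 2 / (1 + xi ^+ 2).
Proof.
have cN : continuous (fun x : R => expR (- `|x|)).
  apply: cts_comp; first exact: continuous_expR.
  by apply/ctsN/cts_norm; exact: cts_id.
have cE : continuous (fun x : R => expR (- x)).
  by apply: cts_comp; [exact: continuous_expR|apply/ctsN/cts_id].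
have cC : continuous (fun x : R => 1 + cos (x * xi)).
  apply: ctsD; first exact: cts_cst.
  apply: cts_comp; first exact: continuous_cos.
  by apply: ctsM; [exact: cts_id|exact: cts_cst].
have dE (x : R) : is_derive x 1 (fun x : R => - expR (- x)) (expR (- x)).
  by apply: is_derive_eq; rewrite mulrN1 opprK.
have E0 : (expR (- x) @[x --> +oo%R] --> (0 : R)).
  apply/cvgrPdist_lt => e e0; near=> x.
  rewrite sub0r normrN gtr0_norm ?expR_gt0// expRN invf_plt ?posrE ?expR_gt0//.
  apply: (@lt_le_trans _ _ (1 + x)); last exact: expR_ge1Dx.
  by rewrite -ltrBlDl; near: x; apply: nbhs_pinfty_gt; rewrite num_real.
have h1 : (\int[leb]_x (expR (- `|x|))%:E = 2%:E)%E.
  rewrite ge0_symfun_integralT//; last by move=> x /=; rewrite normrN.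
  rewrite -set_itvcy.
  rewrite (_ : \int[leb]_(x in _) _ = \int[leb]_(x in `[0%R, +oo[) (expR (- x))%:E)%E; last first.
    by apply: eq_integral; move=> x; rewrite inE/= in_itv/= andbT => x0; rewrite ger0_norm.
  rewrite (@ge0_continuous_FTC2y _ _ (fun x => - expR (- x)) 0 0)//.
  - by rewrite oppr0 expR0 -EFinB sub0r opprK -EFinM mulr1.
  - exact: continuous_subspaceT.
  - by rewrite -oppr0; apply: cvgN.
  - apply: cvg_at_right_filter; exact: (is_derive_continuous (dE 0)).
  - by move=> x _; rewrite derive1E; exact: derive_val.
have ie : L1 (fun x => expR (- `|x|)).
  apply/integrableP; split; first by apply/measurable_EFinP; exact: continuous_measurable_fun.
  under eq_integral do rewrite /= ger0_norm ?expR_ge0//.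
  by rewrite h1 ltry.
split => //.
have c1 : 1 + xi ^+ 2 != 0 by rewrite lt0r_neq0// ltr_pwDl// sqr_ge0.
(* The fraction is an antiderivative of [expR (- x) * cos (x * xi)], and the last term one of
   [expR (- x)]. *)
pose F (x : R) := expR (- x) * (xi * sin (x * xi) - cos (x * xi)) / (1 + xi ^+ 2) - expR (- x).
have dF (x : R) : is_derive x 1 F (expR (- x) * (1 + cos (x * xi))).
  have dS := is_derive_sin_mulr xi x; have dC := is_derive_cos_mulr xi x.
  apply: is_derive_eq; rewrite /GRing.scale/=; field; exact: c1.
have cf : continuous (fun x : R => expR (- `|x|) * (1 + cos (x * xi))).
  exact: ctsM.
have f0 x : 0 <= expR (- `|x|) * (1 + cos (x * xi)).
  by rewrite mulr_ge0 ?expR_ge0// -lerBlDl sub0r cos_geN1.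
have h2 : (\int[leb]_x (expR (- `|x|) * (1 + cos (x * xi)))%:E = (2 + 2 / (1 + xi ^+ 2))%:E)%E.
  rewrite ge0_symfun_integralT//; last first.
    by move=> x /=; rewrite normrN mulNr cosN.
  rewrite -set_itvcy.
  rewrite (_ : \int[leb]_(x in _) _ = \int[leb]_(x in `[0%R, +oo[) (expR (- x) * (1 + cos (x * xi)))%:E)%E; last first.
    by apply: eq_integral; move=> x; rewrite inE/= in_itv/= andbT => x0; rewrite ger0_norm.
  rewrite (@ge0_continuous_FTC2y _ _ F 0 0)//.
  - rewrite -EFinB -EFinM /F !mul0r sin0 cos0 oppr0 expR0; congr EFin.
    by field.
  - by apply: continuous_subspaceT; apply: ctsM.
  - rewrite [X in _ --> X](_ : 0 = 0 / (1 + xi ^+ 2) - 0); last by rewrite mul0r subr0.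
    apply: cvgB => //; apply: cvgMl.
    apply/norm_cvg0P; apply: (@squeeze_cvgr _ _ _ _ (cst 0) (fun x => expR (- x) * (`|xi| + 1))).
    + near=> x; rewrite normr_ge0/= normrM ger0_norm ?expR_ge0//.
      rewrite ler_wpM2l ?expR_ge0// (le_trans (ler_normB _ _))// lerD//.
        by rewrite normrM ler_piMr// sin_max.
      by rewrite cos_max.
    + exact: cvg_cst.
    + by rewrite -[X in _ --> X](mul0r (`|xi| + 1)); apply: cvgMl.
  - apply: cvg_at_right_filter; exact: (is_derive_continuous (dF 0)).
  - by move=> x _; rewrite derive1E; exact: derive_val.
have i2 : L1 (fun x => expR (- `|x|) * (1 + cos (x * xi))).
  apply/integrableP; split; first by apply/measurable_EFinP; exact: continuous_measurable_fun.
  under eq_integral do rewrite /= ger0_norm//.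
  by rewrite h2 ltry.
have e2 : \int[leb]_x (expR (- `|x|) * (1 + cos (x * xi))) = 2 + 2 / (1 + xi ^+ 2).
  by rewrite /Rintegral h2.
have e1 : \int[leb]_x (expR (- `|x|)) = 2 by rewrite /Rintegral h1.
transitivity (2 + 2 / (1 + xi ^+ 2) - 2 : R); last by ring.
rewrite -e2 -[X in _ - X]e1 -RintegralTB//.
by apply: eq_Rintegral => x _; ring.
Unshelve. all: by end_near. Qed.

End integral_toolkit.

(** * Smooth, rapidly decreasing, Schwartz and test functions with real values *)

Section smooth_functions.
Context {R : realType}.
Local Notation leb := (@lebesgue_measure R).
Implicit Types f g h : R -> R.

Definition smooth f := forall (l : nat) (x : R), derivable (derive1n l f) x 1.

(** A coinduction principle: exhibiting a class stable under differentiation replaces any formula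
    for higher derivatives. *)
Lemma smooth_coind (P : (R -> R) -> Prop) :
  (forall f, P f -> (forall x : R, derivable f x 1) /\ P (derive1 f)) ->
  forall f, P f -> smooth f.
Proof.
move=> H f Pf l; elim: l f Pf => [|l ih] f Pf x; first exact: (H f Pf).1.
by rewrite derive1Sn; apply: ih; exact: (H f Pf).2.
Qed.

Lemma smooth_derive1 f : smooth f -> smooth (derive1 f).
Proof. by move=> sf l x; rewrite -derive1Sn; exact: sf. Qed.

Lemma smooth_is_derive f x : smooth f -> is_derive x (1 : R) f ((derive1 f) x).
Proof. by move=> sf; apply: DeriveDef; [exact: (sf 0)|rewrite derive1E]. Qed.

Lemma derive1_is_derive f (f' : R -> R) :
  (forall x, is_derive x (1 : R) f (f' x)) -> (derive1 f) = f'.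
Proof. by move=> df; apply/funext => x; rewrite derive1E; exact: derive_val. Qed.

Lemma smooth_continuous f : smooth f -> continuous f.
Proof. by move=> sf x; apply: is_derive_continuous (smooth_is_derive x sf). Qed.

(* A class of functions closed under differentiation: smoothness of products
   follows without Leibniz' formula for higher derivatives. *)
Inductive smooth_alg : (R -> R) -> Prop :=
| smooth_alg_base f : smooth f -> smooth_alg f
| smooth_algD f g : smooth_alg f -> smooth_alg g -> smooth_alg (fun x => f x + g x)
| smooth_algM f g : smooth_alg f -> smooth_alg g -> smooth_alg (fun x => f x * g x).

Lemma smooth_alg_derive f : smooth_alg f ->
  exists f', smooth_alg f' /\ forall x, is_derive x (1 : R) f (f' x).
Proof.
elim=> {f} [f sf|f g sf [f' [sf' df]] sg [g' [sg' dg]]|f g sf [f' [sf' df]] sg [g' [sg' dg]]].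
- exists (derive1 f); split; first exact/smooth_alg_base/smooth_derive1.
  by move=> x; exact: smooth_is_derive.
- exists (fun x => f' x + g' x); split; first exact: smooth_algD.
  by move=> x; apply: is_deriveD.
- exists (fun x => f x * g' x + g x * f' x); split.
    by apply: smooth_algD; apply: smooth_algM.
  by move=> x; apply: is_deriveM.
Qed.

Lemma smooth_algP f : smooth_alg f -> smooth f.
Proof.
apply: smooth_coind => {}f /smooth_alg_derive[f' [sf' df]]; split.
  by move=> x; have := df x => ?; exact: ex_derive.
by rewrite (derive1_is_derive df).
Qed.

Lemma smoothD f g : smooth f -> smooth g -> smooth (fun x => f x + g x).
Proof. by move=> sf sg; apply/smooth_algP/smooth_algD; exact: smooth_alg_base. Qed.

Lemma smoothM f g : smooth f -> smooth g -> smooth (fun x => f x * g x).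
Proof. by move=> sf sg; apply/smooth_algP/smooth_algM; exact: smooth_alg_base. Qed.

Lemma smooth_cst (c : R) : smooth (fun _ => c).
Proof.
apply: (@smooth_coind (fun f => exists c, f = fun _ => c)); last by exists c.
move=> f [{}c ->]; split => [x|]; first exact: ex_derive.
by exists 0; apply: derive1_is_derive => x.
Qed.

Lemma smooth_id : smooth (fun x => x).
Proof.
case=> [|l] x; first exact: ex_derive.
rewrite derive1Sn (_ : derive1 _ = (fun _ : R => 1 : R)); first exact: smooth_cst.
by apply: derive1_is_derive => y.
Qed.

Lemma is_derive_affine f (d c e x : R) : is_derive (c * x + e) (1 : R) f d ->
  is_derive x (1 : R) (fun t : R => f (c * t + e)) (d * c).
Proof.
move=> df; have dm : is_derive x (1 : R) (fun t : R => c * t + e) c.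
  by have := is_derive_mull c x => dm; apply: is_derive_eq; rewrite addr0.
exact: (is_derive1_comp (f := f) (g := fun t => c * t + e) df dm).
Qed.

Lemma derive1n_affine f (c e : R) l : smooth f ->
  derive1n l (fun x => f (c * x + e)) = fun x => c ^+ l * derive1n l f (c * x + e).
Proof.
move=> sf; elim: l => [|l ih]; first by apply/funext => x; rewrite !derive1n0 expr0 mul1r.
rewrite !derive1nS ih; apply: derive1_is_derive => x.
have dl : is_derive (c * x + e) (1 : R) (derive1n l f) (derive1 (derive1n l f) (c * x + e)).
  by apply: DeriveDef; [exact: sf|rewrite derive1E].
have := is_derive_affine dl => dm.
by apply: is_derive_eq; rewrite /GRing.scale/= exprSr; ring.
Qed.

Lemma smooth_affine f (c e : R) : smooth f -> smooth (fun x => f (c * x + e)).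
Proof.
move=> sf l x; rewrite derive1n_affine//.
have dl : is_derive (c * x + e) (1 : R) (derive1n l f) (derive1 (derive1n l f) (c * x + e)).
  by apply: DeriveDef; [exact: sf|rewrite derive1E].
have := is_derive_affine dl => dm.
exact: ex_derive.
Qed.

Definition rapid f := forall k : nat, exists M : R, forall x, `|x| ^+ k * `|f x| <= M.

Definition rschwartz f := smooth f /\ forall l : nat, rapid (derive1n l f).

Lemma rschwartz_coind (P : (R -> R) -> Prop) :
  (forall f, P f -> [/\ (forall x : R, derivable f x 1), P (derive1 f) & rapid f]) ->
  forall f, P f -> rschwartz f.
Proof.
move=> H f Pf; split.
  by apply: (smooth_coind (P := P)) => // g /H[].
move=> l; elim: l f Pf => [|l ih] f Pf; first by case: (H f Pf).
by rewrite derive1Sn; apply: ih; case: (H f Pf).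
Qed.

Lemma rschwartz_derive1 f : rschwartz f -> rschwartz (derive1 f).
Proof.
move=> [sf rf]; split; first exact: smooth_derive1.
by move=> l; rewrite -derive1Sn.
Qed.

Lemma rapidD f g : rapid f -> rapid g -> rapid (fun x => f x + g x).
Proof.
move=> rf rg k; have [M fM] := rf k; have [N gN] := rg k.
exists (M + N) => x; apply: le_trans (lerD (fM x) (gN x)).
by rewrite -mulrDr ler_wpM2l// ler_normD.
Qed.

Lemma rapidZ c f : rapid f -> rapid (fun x => c * f x).
Proof.
move=> rf k; have [M fM] := rf k; exists (`|c| * M) => x.
by rewrite normrM mulrCA ler_wpM2l.
Qed.

Lemma rschwartzD f g : rschwartz f -> rschwartz g -> rschwartz (fun x => f x + g x).
Proof.
move=> sf sg; apply: (@rschwartz_coind (fun h => exists f g, [/\ rschwartz f, rschwartz g &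
  h = fun x => f x + g x])); last by exists f, g.
move=> h [{}f [{}g [{}sf {}sg ->]]]; split.
- move=> x; have := smooth_is_derive x sf.1; have := smooth_is_derive x sg.1 => ? ?.
  exact: ex_derive.
- exists (derive1 f), (derive1 g); split; [exact: rschwartz_derive1..|].
  apply: derive1_is_derive => x.
  have := smooth_is_derive x sf.1; have := smooth_is_derive x sg.1 => ? ?.
  exact: is_deriveD.
- by apply: rapidD; [exact: (sf.2 0)|exact: (sg.2 0)].
Qed.

Lemma rschwartzZ c f : rschwartz f -> rschwartz (fun x => c * f x).
Proof.
move=> sf; apply: (@rschwartz_coind (fun h => exists f, rschwartz f /\
  h = fun x => c * f x)); last by exists f.
move=> h [{}f [{}sf ->]]; have d x : is_derive x (1 : R) (fun x => c * f x) (c * (derive1 f) x).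
  have := smooth_is_derive x sf.1 => ?.
  by apply: is_derive_eq; rewrite /GRing.scale/=; ring.
split.
- by move=> x; have := d x => ?; exact: ex_derive.
- by exists (derive1 f); split; [exact: rschwartz_derive1|exact: derive1_is_derive].
- exact/rapidZ/(sf.2 0).
Qed.

Lemma rapid_bounded f : rapid f -> exists M : R, forall x, `|f x| <= M.
Proof. by move=> /(_ 0)[M fM]; exists M => x; have := fM x; rewrite expr0 mul1r. Qed.

(** Splitting at [|x| = 1] gives [(1 + |x|)^n <= 2^n max(1, |x|^n)]. The weight [1 + |x|] is
    preferred later because it satisfies [1 + |x + y| <= (1 + |x|) (1 + |y|)]. *)
Lemma rapid_poly f n : rapid f -> exists M : R, forall x, (1 + `|x|) ^+ n * `|f x| <= M.
Proof.
move=> rf; have [M fM] := rf 0; have [N fN] := rf n.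
exists (2 ^+ n * (M + N)) => x.
have M0 : `|f x| <= M by have := fM x; rewrite expr0 mul1r.
have Mge : 0 <= M by apply: le_trans M0.
have Nge : 0 <= N by apply: le_trans (fN x); rewrite mulr_ge0// exprn_ge0.
have [x1|x1] := leP `|x| 1.
- apply: (@le_trans _ _ (2 ^+ n * M)).
    apply: ler_pM => //.
    by apply: lerXn2r; rewrite ?nnegrE ?addr_ge0//; lra.
  by rewrite ler_wpM2l ?exprn_ge0// lerDl.
- apply: (@le_trans _ _ (2 ^+ n * N)); last by rewrite ler_wpM2l ?exprn_ge0// lerDr.
  apply: (@le_trans _ _ (2 ^+ n * (`|x| ^+ n * `|f x|))); last by rewrite ler_wpM2l ?exprn_ge0.
  rewrite mulrA -exprMn ler_wpM2r//.
  by apply: lerXn2r; rewrite ?nnegrE ?addr_ge0 ?mulr_ge0//; lra.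
Qed.

Lemma poly_rapid f : (forall n, exists M, forall x, (1 + `|x|) ^+ n * `|f x| <= M) -> rapid f.
Proof.
move=> H k; have [M fM] := H k; exists M => x; apply: le_trans (fM x).
rewrite ler_wpM2r//; apply: lerXn2r; rewrite ?nnegrE ?addr_ge0//; lra.
Qed.

Lemma rapid_affine f (c e : R) : c != 0 -> rapid f -> rapid (fun x => f (c * x + e)).
Proof.
move=> c0 rf; apply: poly_rapid => n; have [M fM] := rapid_poly n rf.
(* Chosen so that [1 + |x| <= B (1 + |c x + e|)], which follows from [x = c^-1 ((c x + e) - e)]. *)
pose B := 1 + `|c^-1| * (1 + `|e|).
have B0 : 0 <= B by rewrite addr_ge0// mulr_ge0// addr_ge0.
exists (B ^+ n * M) => x; apply: le_trans (_ : B ^+ n * ((1 + `|c * x + e|) ^+ n * `|f (c * x + e)|) <= _); last first.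
  by rewrite ler_wpM2l ?exprn_ge0.
rewrite mulrA -exprMn ler_wpM2r//; apply: lerXn2r; rewrite ?nnegrE ?addr_ge0 ?mulr_ge0 ?addr_ge0//.
have : `|x| <= `|c^-1| * (`|c * x + e| + `|e|).
  rewrite -[X in `|X| <= _](mulKf c0) normrM ler_wpM2l//.
  by rewrite -[X in `|X| <= _](addrK e) ler_normB.
have e0 : 0 <= `|e| by [].
have ci0 : 0 <= `|c^-1| by [].
have t0 : 0 <= `|c * x + e| by [].
rewrite /B; move: (`|x|) (`|c^-1|) (`|c * x + e|) (`|e|) ci0 t0 e0 => X C T E C0 T0 E0 h.
have := mulr_ge0 C0 T0; have := mulr_ge0 (mulr_ge0 C0 E0) T0 => h1 h2; nra.
Qed.

Lemma rschwartz_affine f (c e : R) : c != 0 -> rschwartz f ->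
  rschwartz (fun x => f (c * x + e)).
Proof.
move=> c0 [sf rf]; split; first exact: smooth_affine.
by move=> l; rewrite derive1n_affine//; apply: rapidZ; exact: rapid_affine.
Qed.

(** Of the [n + 2] powers of [1 + |x|] that [f] absorbs, [n] pay for the growth of [g] and two for
    the factor [1 + x^2]. *)
Lemma rapid_L1M f n g : measurable_fun setT f -> measurable_fun setT g -> rapid f ->
  (forall x, `|g x| <= (1 + `|x|) ^+ n) -> L1 (fun x => g x * f x).
Proof.
move=> mf mg rf gn; have [M fM] := rapid_poly n.+2 rf.
apply: (@L1_decay _ _ M); first exact: measurable_funM.
move=> x; apply: le_trans (fM x); rewrite normrM mulrA ler_wpM2r// -[n.+2]/(2 + n)%N exprD.
apply: ler_pM => //; first by rewrite addr_ge0// sqr_ge0.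
have := normr_ge0 x => x0; rewrite -[in X in X <= _](real_normK (num_real x)); nra.
Qed.

Lemma rapid_L1 f : measurable_fun setT f -> rapid f -> L1 f.
Proof.
move=> mf rf; have := @rapid_L1M f 0 (fun => 1) mf (measurable_cst _) rf.
rewrite /L1; under eq_fun do rewrite mul1r.
by apply => x; rewrite expr0 normr1.
Qed.

Lemma rschwartz_rapid f : rschwartz f -> rapid f.
Proof. by move=> sf; exact: (sf.2 0). Qed.

Lemma rschwartz_continuous f : rschwartz f -> continuous f.
Proof. by move=> [sf _]; exact: smooth_continuous. Qed.

Lemma rschwartz_measurable f : rschwartz f -> measurable_fun setT f.
Proof. by move=> sf; apply: continuous_measurable_fun; exact: rschwartz_continuous. Qed.

Lemma rschwartz_L1 f : rschwartz f -> L1 f.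
Proof. by move=> sf; apply: rapid_L1; [exact: rschwartz_measurable|exact: (sf.2 0)]. Qed.

Definition rtest f := smooth f /\ exists A : R, forall x, A < `|x| -> f x = 0.

Lemma rtest_derive1 f : rtest f -> rtest (derive1 f).
Proof.
move=> [sf [A fA]]; split; first exact: smooth_derive1.
exists A => x Ax; rewrite derive1E.
have d0 : is_derive x (1 : R) (fun _ : R => 0 : R) 0 by exact: is_derive_cst.
rewrite (near_eq_derive (g := fun => 0)) ?oner_neq0//; first exact: derive_val.
have /cvgr_gt/(_ A Ax) : `|y| @[y --> x] --> `|x| by exact: norm_continuous.
by apply: filterS => y /fA ->.
Qed.

Lemma rtestM f g : rtest f -> smooth g -> rtest (fun x => g x * f x).
Proof.
move=> [sf [A fA]] sg; split; first exact: smoothM.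
by exists A => x Ax; rewrite fA// mulr0.
Qed.

Lemma rtestD f g : rtest f -> rtest g -> rtest (fun x => f x + g x).
Proof.
move=> [sf [A fA]] [sg [B gB]]; split; first exact: smoothD.
by exists (Num.max A B) => x; rewrite gt_max => /andP[? ?]; rewrite fA// gB// addr0.
Qed.

Lemma rtestZ c f : rtest f -> rtest (fun x => c * f x).
Proof. by move=> tf; apply: rtestM => //; exact: smooth_cst. Qed.

Lemma rtest_mulx f : rtest f -> rtest (fun x => x * f x).
Proof. by move=> tf; apply: rtestM => //; exact: smooth_id. Qed.

Lemma rtest_scale f c : c != 0 -> rtest f -> rtest (fun x => f (c * x)).
Proof.
move=> c0 [sf [A fA]]; split.
  have := @smooth_affine f c 0 sf; congr smooth; apply/funext => x; rewrite addr0//.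
exists (A / `|c|) => x; rewrite ltr_pdivrMr ?normr_gt0// => Ax; apply: fA.
by rewrite normrM mulrC.
Qed.

Lemma rtest_rapid f : rtest f -> rapid f.
Proof.
move=> [sf [A fA]].
(* The radius [A] may be negative; the maximum with [0] keeps the interval nonempty. *)
have : exists M, forall x, x \in `[- (Num.max 0 A), Num.max 0 A] -> `|f x| <= M.
  have A0 : 0 <= Num.max 0 A by rewrite le_max lexx.
  have ab : - Num.max 0 A <= Num.max 0 A by lra.
  have cf : {within `[- (Num.max 0 A), Num.max 0 A], continuous (fun x => `|f x|)}.
    by apply: continuous_subspaceT; apply: cts_norm; exact: smooth_continuous.
  have [c _ cM] := EVT_max ab cf.
  by exists `|f c|.
move=> [M fM] k; exists (Num.max 0 A ^+ k * M) => x.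
have A0 : 0 <= Num.max 0 A by rewrite le_max lexx.
have M0 : 0 <= M.
  by apply: le_trans (fM 0 _) => //; rewrite in_itv/= oppr_le0 A0.
have [Ax|xA] := ltP (Num.max 0 A) `|x|.
  rewrite fA; last by apply: le_lt_trans Ax; rewrite le_max lexx orbT.
  by rewrite normr0 mulr0 mulr_ge0// exprn_ge0.
apply: ler_pM => //.
  by apply: lerXn2r; rewrite ?nnegrE.
by apply: fM; rewrite in_itv/= -ler_norml.
Qed.

Lemma rtest_rschwartz f : rtest f -> rschwartz f.
Proof.
apply: (rschwartz_coind (P := rtest)) => {}f tf; split.
- exact: (tf.1 0).
- exact: rtest_derive1.
- exact: rtest_rapid.
Qed.

Lemma rtest_L1 f : rtest f -> L1 f.
Proof. by move=> /rtest_rschwartz; exact: rschwartz_L1. Qed.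

Lemma Rintegral_derive1_test f : rtest f -> \int[leb]_x (derive1 f) x = 0.
Proof.
move=> tf; have [sf [A fA]] := tf; have [_ [B fB]] := rtest_derive1 tf.
(* Strictly beyond the supports of [f] and of its derivative: the boundary terms vanish and the
   integral reduces to [[- C, C]]. *)
pose C := Num.max 0 (Num.max A B) + 1.
have C0 : 0 < C by rewrite ltr_wpDl// le_max lexx.
have AC : A < C by rewrite /C ltr_pwDr// !le_max lexx orbT.
have BC : B < C by rewrite /C ltr_pwDr// !le_max lexx !orbT.
have Cn : - C < C by lra.
have cf := smooth_continuous sf; have cf' := smooth_continuous (smooth_derive1 sf).
have := @continuous_FTC2 _ (derive1 f) f (- C) C Cn.
rewrite fA; last by rewrite gtr0_norm.
rewrite fA; last by rewrite normrN gtr0_norm.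
rewrite sube0 => H.
rewrite /Rintegral [X in fine X](_ : _ = 0%E)// -[RHS]H; last 3 first.
- exact: continuous_subspaceT.
- split.
  + by move=> x _; exact: (sf 0).
  + by apply: cvg_at_right_filter; exact: cf.
  + by apply: cvg_at_left_filter; exact: cf.
- by [].
rewrite [RHS]integral_mkcond; apply: eq_integral => x _.
rewrite restrict_EFin /= patchE; case: ifPn => //.
rewrite notin_setE /= in_itv/= => /negP; rewrite -ler_norml -ltNge => Cx.
by rewrite fB//; apply: lt_trans Cx.
Qed.

End smooth_functions.

(** * Cosine and sine transforms, Fourier inversion at the origin, spectral orthogonality *)

Section trigonometric_transforms.
Context {R : realType}.
Local Notation leb := (@lebesgue_measure R).
Implicit Types f g h : R -> R.

(** For real [h], the real and imaginary parts of the unnormalised Fourier integral with kernel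
    [e^(i x xi)]. *)
Definition cosT h (x : R) : R := \int[leb]_xi (cos (x * xi) * h xi).
Definition sinT h (x : R) : R := \int[leb]_xi (sin (x * xi) * h xi).

Lemma cos_norm_le1 (x : R) : `|cos x| <= 1.
Proof. by rewrite cos_max. Qed.

Lemma sin_norm_le1 (x : R) : `|sin x| <= 1.
Proof. by rewrite sin_max. Qed.

Lemma cts_cosM (x : R) : continuous (fun xi : R => cos (x * xi)).
Proof.
apply: cts_comp; first exact: continuous_cos.
by apply: ctsM; [exact: cts_cst|exact: cts_id].
Qed.

Lemma cts_sinM (x : R) : continuous (fun xi : R => sin (x * xi)).
Proof.
apply: cts_comp; first exact: continuous_sin.
by apply: ctsM; [exact: cts_cst|exact: cts_id].
Qed.

Lemma L1_bddM f g : continuous f -> (forall x, `|f x| <= 1) -> L1 g ->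
  L1 (fun x => f x * g x).
Proof.
move=> cf f1 gi; apply: (L1_le (g := fun x => `|g x|)) (L1_norm gi).
  by apply: measurable_funM; [exact: continuous_measurable_fun|exact: L1_measurable].
by move=> x; rewrite normrM ler_piMl.
Qed.

Lemma L1_cosM h x : L1 h -> L1 (fun xi => cos (x * xi) * h xi).
Proof. by apply: L1_bddM; [exact: cts_cosM|move=> ?; exact: cos_norm_le1]. Qed.

Lemma L1_sinM h x : L1 h -> L1 (fun xi => sin (x * xi) * h xi).
Proof. by apply: L1_bddM; [exact: cts_sinM|move=> ?; exact: sin_norm_le1]. Qed.

Lemma cosT_norm_le h x : L1 h -> `|cosT h x| <= \int[leb]_xi `|h xi|.
Proof.
move=> hi; apply: L1_norm_le; first exact: L1_norm.
  by apply: L1_measurable; exact: L1_cosM.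
by move=> xi; rewrite normrM ler_piMl// cos_norm_le1.
Qed.

Lemma sinT_norm_le h x : L1 h -> `|sinT h x| <= \int[leb]_xi `|h xi|.
Proof.
move=> hi; apply: L1_norm_le; first exact: L1_norm.
  by apply: L1_measurable; exact: L1_sinM.
by move=> xi; rewrite normrM ler_piMl// sin_norm_le1.
Qed.

Lemma cosTZ c h x : L1 h -> cosT (fun xi => c * h xi) x = c * cosT h x.
Proof.
move=> hi; rewrite /cosT -RintegralTZ; last exact: L1_cosM.
by apply: eq_Rintegral => xi _; ring.
Qed.

Lemma sinTZ c h x : L1 h -> sinT (fun xi => c * h xi) x = c * sinT h x.
Proof.
move=> hi; rewrite /sinT -RintegralTZ; last exact: L1_sinM.
by apply: eq_Rintegral => xi _; ring.
Qed.

Lemma cosTB g h x : L1 g -> L1 h -> cosT (fun xi => g xi - h xi) x = cosT g x - cosT h x.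
Proof.
move=> gi hi; rewrite /cosT -RintegralTB; [|exact: L1_cosM..].
by apply: eq_Rintegral => xi _; ring.
Qed.

Lemma sinTB g h x : L1 g -> L1 h -> sinT (fun xi => g xi - h xi) x = sinT g x - sinT h x.
Proof.
move=> gi hi; rewrite /sinT -RintegralTB; [|exact: L1_sinM..].
by apply: eq_Rintegral => xi _; ring.
Qed.

Lemma sinT_odd h x : L1 h -> sinT h (- x) = - sinT h x.
Proof.
move=> hi; rewrite -[RHS]mulN1r -sinTZ//; apply: eq_Rintegral => xi _.
by rewrite mulNr sinN; ring.
Qed.

Lemma cosT_even h x : cosT h (- x) = cosT h x.
Proof. by apply: eq_Rintegral => xi _; rewrite mulNr cosN. Qed.

Lemma is_derive_cosT h (x : R) : rtest h ->
  is_derive x (1 : R) (cosT h) (sinT (fun xi => (-1) * (xi * h xi)) x).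
Proof.
move=> th; have hi := rtest_L1 th; have xhi := rtest_L1 (rtest_mulx th).
have := @is_derive_Rintegral R (fun x xi => cos (x * xi) * h xi)
  (fun x xi => sin (x * xi) * ((-1) * (xi * h xi))) (fun _ xi => `|xi * h xi|) x.
apply.
- by move=> y; exact: L1_cosM.
- move=> y xi; have := is_derive_cos_mulr xi y => dc.
  by apply: is_derive_eq; rewrite /GRing.scale/=; ring.
- exact: L1_norm.
- by move=> z xi _; rewrite normrM mulN1r normrN ler_piMl// sin_norm_le1.
Qed.

Lemma is_derive_sinT h (x : R) : rtest h ->
  is_derive x (1 : R) (sinT h) (cosT (fun xi => xi * h xi) x).
Proof.
move=> th; have hi := rtest_L1 th; have xhi := rtest_L1 (rtest_mulx th).
have := @is_derive_Rintegral R (fun x xi => sin (x * xi) * h xi)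
  (fun x xi => cos (x * xi) * (xi * h xi)) (fun _ xi => `|xi * h xi|) x.
apply.
- by move=> y; exact: L1_sinM.
- move=> y xi; have := is_derive_sin_mulr xi y => dc.
  by apply: is_derive_eq; rewrite /GRing.scale/=; ring.
- exact: L1_norm.
- by move=> z xi _; rewrite normrM ler_piMl// cos_norm_le1.
Qed.

Lemma is_derive_cos_mull (a x : R) :
  is_derive x (1 : R) (fun t : R => cos (a * t)) (- a * sin (a * x)).
Proof.
rewrite mulNr -mulrN mulrC.
exact: (is_derive1_comp (f := cos) (is_derive_cos _) (is_derive_mull a x)).
Qed.

Lemma is_derive_sin_mull (a x : R) :
  is_derive x (1 : R) (fun t : R => sin (a * t)) (a * cos (a * x)).
Proof.
rewrite mulrC.
exact: (is_derive1_comp (f := sin) (is_derive_sin _) (is_derive_mull a x)).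
Qed.

Lemma smooth_cosM (x : R) : smooth (fun xi : R => cos (x * xi)).
Proof.
apply: (@smooth_coind _ (fun f => exists a b : R, f = fun xi => a * cos (x * xi) + b * sin (x * xi))).
  move=> f [a [b ->]].
  have d (y : R) : is_derive y (1 : R) (fun xi => a * cos (x * xi) + b * sin (x * xi))
     ((b * x) * cos (x * y) + (- a * x) * sin (x * y)).
    have := is_derive_cos_mull x y; have := is_derive_sin_mull x y => ? ?.
    by apply: is_derive_eq; rewrite /GRing.scale/=; ring.
  split; first by move=> y; have := d y => ?; exact: ex_derive.
  by exists (b * x), (- a * x); rewrite (derive1_is_derive d).
by exists 1, 0; apply/funext => xi; rewrite mul1r mul0r addr0.
Qed.

Lemma smooth_sinM (x : R) : smooth (fun xi : R => sin (x * xi)).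
Proof.
have [->|x0] := eqVneq x 0.
  rewrite (_ : (fun _ => _) = (fun=> 0)); first exact: smooth_cst.
  by apply/funext => y; rewrite mul0r sin0.
have := smooth_derive1 (@smooth_cosM x).
rewrite (derive1_is_derive (is_derive_cos_mull x)) => h.
have := smoothM (@smooth_cst R (- x^-1)) h; congr smooth.
by apply/funext => y; field.
Qed.

Lemma L1_Mbdd f g : L1 f -> continuous g -> (forall x, `|g x| <= 1) ->
  L1 (fun x => f x * g x).
Proof.
move=> fi cg g1; have := L1_bddM cg g1 fi; congr L1.
by apply/funext => x; rewrite mulrC.
Qed.

(** Integration by parts: the derivative in [xi] of [sin (x * xi) * h xi] has integral zero. *)
Lemma cosT_mulx h x : rtest h -> x * cosT h x = sinT (fun xi => (-1) * derive1 h xi) x.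
Proof.
move=> th; have hi := rtest_L1 th; have th' := rtest_derive1 th; have hi' := rtest_L1 th'.
have tg := rtestM th (@smooth_sinM x).
have dg xi : is_derive xi (1 : R) (fun xi => sin (x * xi) * h xi)
   (x * (cos (x * xi) * h xi) - sin (x * xi) * (- 1 * derive1 h xi)).
  have dh := smooth_is_derive xi th.1.
  have ds := is_derive_sin_mull x xi.
  by apply: is_derive_eq; rewrite /GRing.scale/=; ring.
have := Rintegral_derive1_test tg; rewrite (derive1_is_derive dg).
rewrite RintegralTB; last 2 first.
- by apply: L1Z; exact: L1_cosM.
- by apply: L1_sinM; exact: L1Z.
by rewrite RintegralTZ; [move/eqP; rewrite subr_eq0 => /eqP|exact: L1_cosM].
Qed.

Lemma sinT_mulx h x : rtest h -> x * sinT h x = cosT (derive1 h) x.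
Proof.
move=> th; have hi := rtest_L1 th; have th' := rtest_derive1 th; have hi' := rtest_L1 th'.
have tg := rtestM th (@smooth_cosM x).
have dg xi : is_derive xi (1 : R) (fun xi => cos (x * xi) * h xi)
   (cos (x * xi) * derive1 h xi - x * (sin (x * xi) * h xi)).
  have dh := smooth_is_derive xi th.1.
  have ds := is_derive_cos_mull x xi.
  by apply: is_derive_eq; rewrite /GRing.scale/=; ring.
have := Rintegral_derive1_test tg; rewrite (derive1_is_derive dg).
rewrite RintegralTB; last 2 first.
- exact: L1_cosM.
- by apply: L1Z; exact: L1_sinM.
by rewrite RintegralTZ; [move/eqP; rewrite subr_eq0 => /eqP|exact: L1_sinM].
Qed.

(** Differentiation and multiplication by [x] both exchange the two transforms, so the sums, rather
    than either transform alone, form a class stable under these operations. *)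
Lemma trigT_rschwartz g h : rtest g -> rtest h ->
  rschwartz (fun x => cosT g x + sinT h x).
Proof.
move=> tg th; apply: (@rschwartz_coind R (fun f => exists g h, [/\ rtest g, rtest h &
  f = fun x => cosT g x + sinT h x])); last by exists g, h.
move=> f [{}g [{}h [{}tg {}th ->]]].
have d x : is_derive x (1 : R) (fun x => cosT g x + sinT h x)
    (cosT (fun xi => xi * h xi) x + sinT (fun xi => (-1) * (xi * g xi)) x).
  have := is_derive_cosT x tg; have := is_derive_sinT x th => ? ?.
  by apply: is_derive_eq; rewrite addrC.
split.
- by move=> x; have := d x => ?; exact: ex_derive.
- exists (fun xi => xi * h xi), (fun xi => (-1) * (xi * g xi)); split.
  + exact: rtest_mulx.
  + by apply: rtestZ; exact: rtest_mulx.
  + exact: derive1_is_derive.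
- move=> k; elim: k g h tg th {d} => [|k ih] g h tg th.
    exists (\int[leb]_xi `|g xi| + \int[leb]_xi `|h xi|) => x.
    rewrite expr0 mul1r (le_trans (ler_normD _ _))// lerD//.
      by apply: cosT_norm_le; exact: rtest_L1.
    by apply: sinT_norm_le; exact: rtest_L1.
  (* One factor [x] is traded for a derivative of each amplitude, the two amplitudes changing
     places. *)
  have [M HM] := ih _ _ (rtest_derive1 th) (rtestZ (-1) (rtest_derive1 tg)).
  exists M => x; apply: le_trans (HM x).
  by rewrite exprSr -mulrA -normrM mulrDr cosT_mulx// sinT_mulx// addrC.
Qed.

Lemma rtest0 : rtest (fun _ : R => 0 : R).
Proof. by split; [exact: smooth_cst|exists 0]. Qed.

Lemma cosT_rschwartz h : rtest h -> rschwartz (cosT h).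
Proof.
move=> th; have := trigT_rschwartz th rtest0; congr rschwartz; apply/funext => x.
rewrite /sinT; under eq_Rintegral do rewrite mulr0.
by rewrite Rintegral_cst// mul0r addr0.
Qed.

Lemma sinT_rschwartz h : rtest h -> rschwartz (sinT h).
Proof.
move=> th; have := trigT_rschwartz rtest0 th; congr rschwartz; apply/funext => x.
rewrite /cosT; under eq_Rintegral do rewrite mulr0.
by rewrite Rintegral_cst// mul0r add0r.
Qed.

Lemma cosT_scale h c x : c != 0 -> L1 h -> cosT (fun xi => h (c * xi)) (c * x) = `|c|^-1 * cosT h x.
Proof.
move=> c0 hi; have := Rintegral_affine 0 c0 (L1_cosM x hi); rewrite /cosT => ->.
rewrite mulKf ?normr_eq0//; apply: eq_Rintegral => xi _.
by rewrite addr0; congr (cos _ * _); ring.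
Qed.

Lemma sinT_scale h c x : c != 0 -> L1 h -> sinT (fun xi => h (c * xi)) (c * x) = `|c|^-1 * sinT h x.
Proof.
move=> c0 hi; have := Rintegral_affine 0 c0 (L1_sinM x hi); rewrite /sinT => ->.
rewrite mulKf ?normr_eq0//; apply: eq_Rintegral => xi _.
by rewrite addr0; congr (sin _ * _); ring.
Qed.

(** Its value is [2 pi], but what the proof relies on is that it is positive. *)
Definition inversion_constant : R := \int[leb]_x (2 / (1 + x ^+ 2)).

Lemma inversion_constant_gt0 : 0 < inversion_constant.
Proof.
rewrite /inversion_constant RintegralTZ; last exact: L1_oneDsqrV.
rewrite mulr_gt0// /Rintegral ge0_symfun_integralT; last 3 first.
- by move=> x; rewrite invr_ge0 addr_ge0// sqr_ge0.
- exact: (@continuous_oneDsqrV R).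
- by move=> x /=; rewrite sqrrN.
have := @integral0y_oneDsqr R; rewrite set_itvcy => ->.
by rewrite -EFinM /= mulr_gt0// divr_gt0// pi_gt0.
Qed.

(* [exp (- |x / N|)] is the summability kernel for the inversion at [0]; its
   cosine transform is known in closed form. *)
Lemma cosT_damped h (N : R) : 0 < N -> rtest h ->
  \int[leb]_x (cosT h x * expR (- `|N^-1 * x|)) =
  \int[leb]_eta (2 / (1 + eta ^+ 2) * h (N^-1 * eta)).
Proof.
move=> Np th; have hi := rtest_L1 th; have ch := cosT_rschwartz th.
have [ei _] := @exp_abs_cos R 0.
have hc := smooth_continuous th.1.
have Nn0 : N != 0 by rewrite gt_eqF.
have Ni0 : N^-1 != 0 by rewrite invr_eq0.
have hNi : L1 (fun xi => h (N^-1 * xi)) by apply: rtest_L1; exact: rtest_scale.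
have Gi : L1 (fun x => cosT h x * expR (- `|N^-1 * x|)).
  apply: L1_Mbdd; first exact: rschwartz_L1.
    apply: cts_comp; first exact: continuous_expR.
    by apply/ctsN/cts_norm; apply: ctsM; [exact: cts_cst|exact: cts_id].
  by move=> x; rewrite ger0_norm ?expR_ge0// -expR0 ler_expR oppr_le0.
(* With [x = N t], the Jacobian [N] and the dilation turn [cosT h] into the transform of
   [h (N^-1 * _)], leaving the undilated [expR (- |t|)] for Fubini. *)
transitivity (\int[leb]_t (\int[leb]_eta (cos (t * eta) * h (N^-1 * eta) * expR (- `|t|)))).
  rewrite (Rintegral_affine 0 Nn0 Gi) -RintegralTZ; last first.
    exact: (integrable_affine 0 Nn0 Gi).
  apply: eq_Rintegral => t _; rewrite addr0 mulKf// mulrA RintegralZr//; last exact: L1_cosM.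
  congr (_ * _); have := cosT_scale (N * t) Ni0 hi.
  by rewrite mulKf// /cosT => ->; rewrite normfV invrK.
rewrite (@Rintegral_Fubini R _ (fun t => expR (- `|t|)) (fun eta => h (N^-1 * eta)))//; last 2 first.
- have mfst : measurable_fun [set: R * R] (fun z : R * R => z.1) by exact: measurable_fst.
  have msnd : measurable_fun [set: R * R] (fun z : R * R => z.2) by exact: measurable_snd.
  apply: measurable_funM; first apply: measurable_funM.
  + apply: (measurableT_comp (f := cos)); last exact: measurable_funM.
    exact: continuous_measurable_fun (@continuous_cos R).
  + by apply: (measurableT_comp (f := fun eta => h (N^-1 * eta))) => //; exact: L1_measurable.
  + by have := measurableT_comp (L1_measurable ei) mfst.
- move=> t eta; rewrite normrM normrM [X in _ <= X]mulrC ler_wpM2r//.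
  by rewrite ler_piMl// cos_norm_le1.
apply: eq_Rintegral => eta _; rewrite -(exp_abs_cos eta).2 -RintegralZr//; last first.
  apply: L1_bddM => // [|x]; last exact: cos_norm_le1.
  apply: cts_comp; first exact: continuous_cos.
  by apply: ctsM; [exact: cts_id|exact: cts_cst].
by apply: eq_Rintegral => t _; ring.
Qed.

Lemma continuous_seq_cvg f (a : nat -> R) (l : R) : continuous f ->
  a n @[n --> \oo] --> l -> f (a n) @[n --> \oo] --> f l.
Proof. by move=> cf al; apply: (cvg_comp a f al); exact: cf. Qed.

(** Dominated convergence on both sides of [cosT_damped] with [N = n + 1]: the damping disappears on
    the left, and [h (eta / N)] tends to [h 0] on the right. *)
Lemma cosT_inversion0 h : rtest h -> \int[leb]_x cosT h x = inversion_constant * h 0.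
Proof.
move=> th; have ch := cosT_rschwartz th.
have [B hB] := rapid_bounded (rtest_rapid th).
have hc := smooth_continuous th.1.
have c1 : \int[leb]_x (cosT h x * expR (- `|n.+1%:R^-1 * x|)) @[n --> \oo] --> \int[leb]_x cosT h x.
  have cx (a : R) : continuous (fun x => expR (- `|a * x|)).
    apply: cts_comp; first exact: continuous_expR.
    by apply/ctsN/cts_norm; apply: ctsM; [exact: cts_cst|exact: cts_id].
  apply: (@L1_dominated R _ _ (fun x => `|cosT h x|) _ _ _ _).2.
  - move=> n; apply: continuous_measurable_fun; apply: ctsM; last exact: cx.
    exact: rschwartz_continuous.
  - by apply: L1_norm; exact: rschwartz_L1.
  - move=> n x; rewrite normrM ler_piMr//.
    by rewrite ger0_norm ?expR_ge0// -expR0 ler_expR oppr_le0.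
  - move=> x.
    have cc : continuous (fun a : R => cosT h x * expR (- `|a * x|)).
      apply: ctsM; first exact: cts_cst.
      apply: cts_comp; first exact: continuous_expR.
      by apply/ctsN/cts_norm; apply: ctsM; [exact: cts_id|exact: cts_cst].
    have := continuous_seq_cvg cc (@cvg_harmonic R).
    by rewrite mul0r normr0 oppr0 expR0 mulr1.
have c2 : \int[leb]_eta (2 / (1 + eta ^+ 2) * h (n.+1%:R^-1 * eta)) @[n --> \oo] --> \int[leb]_eta (2 / (1 + eta ^+ 2) * h 0).
  have wc : continuous (fun x : R => 2 / (1 + x ^+ 2)).
    by apply: ctsM; [exact: cts_cst|exact: (@continuous_oneDsqrV R)].
  apply: (@L1_dominated R _ _ (fun x => B * (2 / (1 + x ^+ 2))) _ _ _ _).2.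
  - move=> n; apply: continuous_measurable_fun; apply: ctsM => //.
    by apply: cts_comp => //; apply: ctsM; [exact: cts_cst|exact: cts_id].
  - by apply: L1Z; apply: L1Z; exact: L1_oneDsqrV.
  - move=> n x; rewrite normrM mulrC [`|2 / _|]ger0_norm; last first.
      by rewrite divr_ge0// addr_ge0// sqr_ge0.
    by rewrite ler_wpM2r// divr_ge0// addr_ge0// sqr_ge0.
  - move=> x.
    have cc : continuous (fun a : R => 2 / (1 + x ^+ 2) * h (a * x)).
      apply: ctsM; first exact: cts_cst.
      by apply: cts_comp => //; apply: ctsM; [exact: cts_id|exact: cts_cst].
    by have := continuous_seq_cvg cc (@cvg_harmonic R); rewrite mul0r.
rewrite /inversion_constant mulrC -RintegralTZ; last by apply: L1Z; exact: L1_oneDsqrV.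
under [RHS]eq_Rintegral do rewrite mulrC.
apply: (cvg_unique (@Rhausdorff R) c1); rewrite (_ : (fun n => _) = fun n : nat =>
  \int[leb]_eta (2 / (1 + eta ^+ 2) * h (n.+1%:R^-1 * eta)))//.
by apply/funext => n; exact: cosT_damped.
Qed.

Lemma sinT_inversion0 h : rtest h -> \int[leb]_x sinT h x = 0.
Proof.
move=> th; apply: RintegralT_odd; first by apply: rschwartz_L1; exact: sinT_rschwartz.
by move=> x; apply: sinT_odd; exact: rtest_L1.
Qed.

Lemma rtest_shift h w : rtest h -> rtest (fun xi => h (xi + w)).
Proof.
move=> [sh [A hA]]; split.
  have := @smooth_affine _ h 1 w sh; congr smooth.
  by apply/funext => x; rewrite mul1r.
exists (A + `|w|) => x Ax; apply: hA; rewrite -ltrBDr in Ax; apply: lt_le_trans Ax _.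
by rewrite lerBlDr -[X in `|X| <= _](addrK w) ler_normB.
Qed.

Lemma Rintegral_shift f w : L1 f -> \int[leb]_x f (x + w) = \int[leb]_x f x.
Proof.
move=> fi; rewrite [RHS](Rintegral_affine w (oner_neq0 R) fi) normr1 mul1r.
by apply: eq_Rintegral => x _; rewrite mul1r.
Qed.

Lemma cosT_shift h (w x : R) : L1 h ->
  cosT (fun xi => h (xi + w)) x = \int[leb]_xi (cos (x * (xi - w)) * h xi).
Proof.
move=> hi; rewrite -(Rintegral_shift w); last first.
  apply: L1_bddM => // [|y]; last exact: cos_norm_le1.
  apply: cts_comp; first exact: continuous_cos.
  by apply: ctsM; [exact: cts_cst|apply: ctsB; [exact: cts_id|exact: cts_cst]].
by apply: eq_Rintegral => xi _; rewrite addrK.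
Qed.

(** Modulation of the transform is translation of the amplitude; through it, inversion at [0] reads
    the amplitude at any frequency [w]. *)
Lemma cosT_mulcos h (w x : R) : rtest h ->
  cosT h x * cos (x * w) = 2^-1 * (cosT (fun xi => h (xi + w)) x + cosT (fun xi => h (xi - w)) x).
Proof.
move=> th; have hi := rtest_L1 th.
have ii a : L1 (fun xi => cos (x * (xi - a)) * h xi).
  apply: L1_bddM => // [|y]; last exact: cos_norm_le1.
  apply: cts_comp; first exact: continuous_cos.
  by apply: ctsM; [exact: cts_cst|apply: ctsB; [exact: cts_id|exact: cts_cst]].
rewrite !cosT_shift// -RintegralTD// -RintegralTZ; last exact: L1D.
rewrite /cosT mulrC -RintegralTZ; last exact: L1_cosM.
apply: eq_Rintegral => xi _.
have -> : x * (xi - w) = x * xi - x * w by ring.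
have -> : x * (xi - - w) = x * xi + x * w by ring.
by rewrite cosB cosD; field.
Qed.

Lemma sinT_mulsin h (w x : R) : rtest h ->
  sinT h x * sin (x * w) = 2^-1 * (cosT (fun xi => h (xi + w)) x - cosT (fun xi => h (xi - w)) x).
Proof.
move=> th; have hi := rtest_L1 th.
have ii a : L1 (fun xi => cos (x * (xi - a)) * h xi).
  apply: L1_bddM => // [|y]; last exact: cos_norm_le1.
  apply: cts_comp; first exact: continuous_cos.
  by apply: ctsM; [exact: cts_cst|apply: ctsB; [exact: cts_id|exact: cts_cst]].
rewrite !cosT_shift// -RintegralTB// -RintegralTZ; last exact: L1B.
rewrite /sinT mulrC -RintegralTZ; last exact: L1_sinM.
apply: eq_Rintegral => xi _.
have -> : x * (xi - w) = x * xi - x * w by ring.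
have -> : x * (xi - - w) = x * xi + x * w by ring.
by rewrite cosB cosD; field.
Qed.

(** Expanding [sin ((x - y) * w)] leaves four integrals. Two vanish by parity; by inversion at [0]
    the others are multiples of [g w + g (- w)] and [h w - h (- w)]. *)
Lemma trigT_orthogonal g h (w x : R) : rtest g -> rtest h ->
  g w = 0 -> g (- w) = 0 -> h w = 0 -> h (- w) = 0 ->
  \int[leb]_y ((cosT g y + sinT h y) * sin ((x - y) * w)) = 0.
Proof.
move=> tg th g1 g2 h1 h2.
have cw : continuous (fun y : R => cos (y * w)).
  apply: cts_comp; first exact: continuous_cos.
  by apply: ctsM; [exact: cts_id|exact: cts_cst].
have sw : continuous (fun y : R => sin (y * w)).
  apply: cts_comp; first exact: continuous_sin.
  by apply: ctsM; [exact: cts_id|exact: cts_cst].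
have c1 (y : R) : `|cos (y * w)| <= 1 by exact: cos_norm_le1.
have s1 (y : R) : `|sin (y * w)| <= 1 by exact: sin_norm_le1.
have gi := rschwartz_L1 (cosT_rschwartz tg).
have hi := rschwartz_L1 (sinT_rschwartz th).
have gc := L1_Mbdd gi cw c1; have gs := L1_Mbdd gi sw s1.
have hc := L1_Mbdd hi cw c1; have hs := L1_Mbdd hi sw s1.
have Igc : \int[leb]_y (cosT g y * cos (y * w)) = 0.
  under eq_Rintegral do rewrite cosT_mulcos//.
  have t1 := rtest_shift w tg; have t2 := rtest_shift (- w) tg.
  have i1 := rschwartz_L1 (cosT_rschwartz t1); have i2 := rschwartz_L1 (cosT_rschwartz t2).
  rewrite RintegralTZ; last exact: L1D.
  by rewrite RintegralTD// !cosT_inversion0// !add0r g1 g2 !(mulr0, addr0).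
have Ihs : \int[leb]_y (sinT h y * sin (y * w)) = 0.
  under eq_Rintegral do rewrite sinT_mulsin//.
  have t1 := rtest_shift w th; have t2 := rtest_shift (- w) th.
  have i1 := rschwartz_L1 (cosT_rschwartz t1); have i2 := rschwartz_L1 (cosT_rschwartz t2).
  rewrite RintegralTZ; last exact: L1B.
  by rewrite RintegralTB// !cosT_inversion0// !add0r h1 h2 !(mulr0, subr0).
have Igs : \int[leb]_y (cosT g y * sin (y * w)) = 0.
  by apply: RintegralT_odd => // y; rewrite cosT_even mulNr sinN mulrN.
have Ihc : \int[leb]_y (sinT h y * cos (y * w)) = 0.
  apply: RintegralT_odd => // y; rewrite sinT_odd; last exact: rtest_L1.
  by rewrite [- y * w]mulNr cosN mulNr.
have iA := L1D gc hc; have iB := L1D gs hs.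
transitivity (\int[leb]_y (sin (x * w) * (cosT g y * cos (y * w) + sinT h y * cos (y * w))
   - cos (x * w) * (cosT g y * sin (y * w) + sinT h y * sin (y * w)))).
  by apply: eq_Rintegral => y _; rewrite mulrBl sinB; ring.
rewrite RintegralTB; [|exact: L1Z..].
by rewrite !RintegralTZ// !RintegralTD// Igc Ihs Igs Ihc !addr0 !mulr0 subrr.
Qed.

End trigonometric_transforms.

(** * Convolution of [|.|^mu] with a Schwartz function and its rigidity under dyadic scaling *)

Section homogeneous_convolution.
Context {R : realType}.
Local Notation leb := (@lebesgue_measure R).
Implicit Types P f g h : R -> R.
Context (mu : R) (mu0 : 0 < mu).

Lemma continuous_powR_norm : continuous (fun w : R => `|w| `^ mu).
Proof.
move=> w; have [->|w0] := eqVneq w 0.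
  apply/cvgrPdist_lt => e e0; rewrite normr0 powR0 ?gt_eqF//.
  suff H : \forall y \near nbhs (0 : R), `|0 - `|y| `^ mu| < e by exact: H.
  apply: filterS (nbhs0_lt (powR_gt0 mu^-1 e0)) => y h.
  rewrite sub0r normrN ger0_norm ?powR_ge0//.
  have := gt0_ltr_powR mu0 _ _ h.
  rewrite -powRrM mulVf ?gt_eqF// powRr1 ?ltW//; apply.
    by rewrite nnegrE.
  by rewrite nnegrE powR_ge0.
apply: (continuous_comp (f := fun w : R => `|w|) (g := fun a => a `^ mu)).
  exact: norm_continuous.
apply: differentiable_continuous; apply/derivable1_diffP; apply: derivable_powR.
by rewrite in_itv/= andbT normr_gt0.
Qed.

(** An integer above [mu]: it bounds the growth of [|w|^mu] polynomially, and after that many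
    derivatives the degree of homogeneity has become negative. *)
Let n := Num.bound mu.

Lemma powR_norm_le (w : R) : `|w| `^ mu <= (1 + `|w|) ^+ n.
Proof.
rewrite -powR_mulrn ?addr_ge0//.
apply: (@le_trans _ _ ((1 + `|w|) `^ mu)).
  by apply: ge0_ler_powR; rewrite ?nnegrE ?addr_ge0 ?lerDr// ltW.
by apply: ler_powR; [rewrite lerDl|apply: ltW; apply: archi_boundP; exact: ltW].
Qed.

(** Uniform for [z] near [z0], as differentiation under the integral requires. The weight moves from
    [w] to [z - w] by [1 + |w| <= (2 + |z0|) (1 + |z - w|)], and the decay of [P] of order [n + 2]
    leaves two powers for integrability. *)
Lemma homconv_bound P (z0 : R) : rapid P -> exists C : R, forall z w : R,
  z0 - 1 < z < z0 + 1 -> `| `|w| `^ mu * P (z - w)| <= C * (1 + w ^+ 2)^-1.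
Proof.
move=> rP; have [M HM] := rapid_poly n.+2 rP.
exists (M * (2 + `|z0|) ^+ n.+2) => z w /andP[z1 z2].
have w2 : 0 < 1 + w ^+ 2 by rewrite ltr_pwDl// sqr_ge0.
have tri : 1 + `|w| <= (2 + `|z0|) * (1 + `|z - w|).
  have a1 : `|w| <= `|z| + `|z - w|.
    by rewrite -[X in `|X| <= _](subKr z) ler_normB.
  have a2 : `|z| <= `|z0| + 1.
    rewrite -[X in `|X| <= _](subrK z0) addrC (le_trans (ler_normD _ _))// lerD//.
    by rewrite ler_norml; apply/andP; split; lra.
  have := normr_ge0 z0; have := normr_ge0 (z - w) => p1 p2.
  have := mulr_ge0 p1 p2; lra.
rewrite normrM ger0_norm ?powR_ge0// ler_pdivlMr//.
apply: (@le_trans _ _ ((1 + `|w|) ^+ n * `|P (z - w)| * (1 + `|w|) ^+ 2)).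
  apply: ler_pM.
  - by rewrite mulr_ge0// powR_ge0.
  - by rewrite ltW.
  - by rewrite ler_wpM2r// powR_norm_le.
  - by have := normr_ge0 w; rewrite -[X in 1 + X](real_normK (num_real w)); nra.
rewrite mulrAC -exprD addn2.
apply: (@le_trans _ _ (((2 + `|z0|) * (1 + `|z - w|)) ^+ n.+2 * `|P (z - w)|)).
  rewrite ler_wpM2r//; apply: lerXn2r => //; rewrite nnegrE ?mulr_ge0// addr_ge0//.
by rewrite exprMn -mulrA mulrC ler_wpM2r ?exprn_ge0 ?addr_ge0.
Qed.

Definition homconv P (z : R) : R := \int[leb]_w (`|w| `^ mu * P (z - w)).

Lemma homconv_measurable P (z : R) : continuous P ->
  measurable_fun setT (fun w : R => `|w| `^ mu * P (z - w)).
Proof.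
move=> cP; apply: continuous_measurable_fun; apply: ctsM.
  exact: continuous_powR_norm.
by apply: cts_comp => //; apply: ctsB; [exact: cts_cst|exact: cts_id].
Qed.

Lemma homconv_L1 P (z : R) : rapid P -> continuous P -> L1 (fun w : R => `|w| `^ mu * P (z - w)).
Proof.
move=> rP cP; have [C HC] := homconv_bound z rP.
apply: (L1_le (g := fun w => C * (1 + w ^+ 2)^-1)).
- exact: homconv_measurable.
- by move=> w; apply: HC; apply/andP; split; lra.
- by apply: L1Z; exact: L1_oneDsqrV.
Qed.

Lemma is_derive_homconv P (z : R) : rschwartz P ->
  is_derive z (1 : R) (homconv P) (homconv (derive1 P) z).
Proof.
move=> sP; have sP' := rschwartz_derive1 sP.
have [C HC] := homconv_bound z (rschwartz_rapid sP').
apply: (@is_derive_Rintegral R (fun x w : R => `|w| `^ mu * P (x - w))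
  (fun x w : R => `|w| `^ mu * derive1 P (x - w)) (fun _ w => C * (1 + w ^+ 2)^-1)).
- by move=> y; apply: homconv_L1; [exact: rschwartz_rapid|exact: rschwartz_continuous].
- move=> y w; have dP := smooth_is_derive (1 * y + - w) sP.1.
  have := is_derive_affine dP => dm.
  rewrite (_ : (fun t => _) = (fun t => `|w| `^ mu * P (1 * t + - w))); last first.
    by apply/funext => t; rewrite mul1r.
  by apply: is_derive_eq; rewrite /GRing.scale/= mul1r; ring.
- by apply: L1Z; exact: L1_oneDsqrV.
- by move=> y w; exact: HC.
Qed.

Lemma homconv_continuous P : rschwartz P -> continuous (homconv P).
Proof. by move=> sP z; apply: is_derive_continuous (is_derive_homconv z sP). Qed.

(* Differentiation lowers the degree of homogeneity by one and flips the parity;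
   a function of negative degree that is continuous at [0] vanishes.  The degree
   is never an integer of the current parity, so an integration constant would
   contradict homogeneity (degree nonzero) or oddness (degree zero). *)
Lemma homconv_vanish (m : nat) P (nu : R) (odd_parity : bool) : rschwartz P ->
  (forall z, homconv P (2 * z) = 2 `^ nu * homconv P z) ->
  (forall z, homconv P (- z) = (-1) ^+ odd_parity * homconv P z) ->
  nu < m%:R -> (forall k : nat, odd k = odd_parity -> nu != k%:R) ->
  forall z, homconv P z = 0.
Proof.
elim: m P nu odd_parity => [|m ih] P nu e sP hd hp num hk z.
  have H j : homconv P z = (2 `^ nu) ^+ j * homconv P (2^-1 ^+ j * z).
    elim: j => [|j ihj]; first by rewrite !expr0 !mul1r.
    rewrite ihj !exprS -mulrA mulrCA; congr (_ * _).
    by rewrite -hd !mulrA mulfV ?mul1r.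
  have c1 : (2 `^ nu) ^+ j @[j --> \oo] --> (0 : R).
    apply: cvg_expr; rewrite ger0_norm ?powR_ge0//.
    by rewrite /powR pnatr_eq0/= -[X in _ < X]expR0 ltr_expR pmulr_llt0 ?ln_gt0 ?ltr1n.
  have c2 : homconv P (2^-1 ^+ j * z) @[j --> \oo] --> homconv P 0.
    apply: (continuous_seq_cvg (homconv_continuous sP)).
    rewrite -[X in _ --> X](mul0r z); apply: cvgMl; apply: cvg_expr.
    by rewrite ger0_norm// invf_lt1// ltr1n.
  have cM : (2 `^ nu) ^+ j * homconv P (2^-1 ^+ j * z) @[j --> \oo] --> 0 * homconv P 0.
    exact: cvgM.
  rewrite mul0r in cM; apply: (cvg_unique (@Rhausdorff R) _ cM).
  rewrite (_ : (fun j => _) = (fun => homconv P z)); first exact: cvg_cst.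
  by apply/funext => j /=; rewrite -H.
have sP' := rschwartz_derive1 sP.
have d0 w : homconv (derive1 P) w = 0.
  apply: (ih (derive1 P) (nu - 1) (~~ e)) => //.
  - move=> y; have D1 : is_derive y (1 : R) (fun t => homconv P (2 * t + 0)) (homconv (derive1 P) (2 * y + 0) * 2).
      by apply: is_derive_affine; exact: is_derive_homconv.
    have D0 := is_derive_homconv y sP.
    have D2 : is_derive y (1 : R) (fun t => 2 `^ nu * homconv P t) (2 `^ nu * homconv (derive1 P) y).
      by apply: is_derive_eq; rewrite /GRing.scale/=; ring.
    have : homconv (derive1 P) (2 * y + 0) * 2 = 2 `^ nu * homconv (derive1 P) y.
      rewrite -(@derive_val _ _ _ _ _ _ _ D1) -(@derive_val _ _ _ _ _ _ _ D2).
      by congr ('D_1 _ y); apply/funext => t; rewrite addr0 hd.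
    rewrite addr0 => h; rewrite powRB ?pnatr_eq0 ?implybT// powRr1//.
    by rewrite mulrAC -h mulfK ?pnatr_eq0.
  - move=> y; have D1 : is_derive y (1 : R) (fun t => homconv P (-1 * t + 0)) (homconv (derive1 P) (-1 * y + 0) * -1).
      by apply: is_derive_affine; exact: is_derive_homconv.
    have D0 := is_derive_homconv y sP.
    have D2 : is_derive y (1 : R) (fun t => (-1) ^+ e * homconv P t) ((-1) ^+ e * homconv (derive1 P) y).
      by apply: is_derive_eq; rewrite /GRing.scale/=; ring.
    have : homconv (derive1 P) (-1 * y + 0) * -1 = (-1) ^+ e * homconv (derive1 P) y.
      rewrite -(@derive_val _ _ _ _ _ _ _ D1) -(@derive_val _ _ _ _ _ _ _ D2).
      by congr ('D_1 _ y); apply/funext => t; rewrite addr0 mulN1r hp.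
    by rewrite addr0 mulN1r mulrN1 => /(congr1 -%R); rewrite opprK => ->; case: (e); rewrite /=; ring.
  - by have := num; rewrite -natr1; lra.
  - move=> k ke; apply/eqP => nuk.
    have := hk k.+1; rewrite /= ke negbK => /(_ erefl)/eqP; apply.
    by rewrite -natr1 -nuk subrK.
have cst w : homconv P w = homconv P 0.
  apply: is_derive_0_is_cst => x.
  by have := is_derive_homconv x sP; rewrite d0.
rewrite cst; have [nu0|nu0] := eqVneq nu 0.
  have e1 : e = true.
    by case: e {hp ih} hk => // /(_ 0 erefl); rewrite nu0 eqxx.
  have := hp 0; rewrite oppr0 e1 expr1 mulN1r => /eqP; rewrite -subr_eq0 opprK.
  by rewrite -mulr2n -mulr_natl mulf_eq0 pnatr_eq0 /= => /eqP.
have := hd 0; rewrite mulr0 => /eqP; rewrite -{1}[homconv P 0]mul1r -subr_eq0 -mulrBl mulf_eq0.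
case/orP => [|/eqP//]; rewrite subr_eq0 eq_sym powR_eq1.
by rewrite (negbTE nu0) orbF => /orP[/eqP|]; lra.
Qed.

(** A substitution in which the homogeneity of [|w|^mu] produces the power of [2]. It converts
    orthogonality to [2 P (2 x) - P x] into a scaling relation for [homconv P]. *)
Lemma homconv_scale P z : rschwartz P ->
  \int[leb]_w (`|w| `^ mu * (2 * P (2 * (z - w)))) = 2 `^ (- mu) * homconv P (2 * z).
Proof.
move=> sP; have cP := rschwartz_continuous sP.
have Li := homconv_L1 (2 * z) (rschwartz_rapid sP) cP.
have two0 : (2 : R) != 0 by rewrite pnatr_eq0.
rewrite /homconv (Rintegral_affine 0 two0 Li) ger0_norm//.
have Li' := integrable_affine 0 two0 Li.
rewrite -RintegralTZ// -RintegralTZ; last exact: L1Z.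
apply: eq_Rintegral => w _; rewrite addr0 normrM ger0_norm// powRM//.
rewrite -mulrBr; set q := P _.
transitivity ((2 `^ (- mu) * 2 `^ mu) * (`|w| `^ mu * (2 * q))); last by ring.
by rewrite powRN mulVf ?mul1r// gt_eqF// powR_gt0.
Qed.

(* [homconv P z] equals [2^(- j mu) homconv P (2^j z)], and the latter tends to
   [|z|^mu \int P]. *)
Lemma homconv_limit P z : rschwartz P ->
  (forall y, homconv P (2 * y) = 2 `^ mu * homconv P y) ->
  homconv P z = `|z| `^ mu * \int[leb]_w P w.
Proof.
move=> sP hd; have cP := rschwartz_continuous sP.
have H j : homconv P z = \int[leb]_w (`|z - 2^-1 ^+ j * w| `^ mu * P w).
  have -> : homconv P z = (2 `^ (- mu)) ^+ j * homconv P (2 ^+ j * z).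
    elim: j => [|j ihj]; first by rewrite !expr0 !mul1r.
    rewrite !exprS -[2 * _ * z]mulrA hd {1}ihj [RHS]mulrACA powRN mulVf ?mul1r//.
  have Li := homconv_L1 (2 ^+ j * z) (rschwartz_rapid sP) cP.
  rewrite /homconv -(Rintegral_sub_var (2 ^+ j * z) Li) -RintegralTZ; last exact: (L1_sub_var (2 ^+ j * z) Li).
  apply: eq_Rintegral => w _; rewrite subKr mulrA; congr (_ * _).
  have p2 : (2 : R) ^+ j != 0 by rewrite expf_neq0// pnatr_eq0.
  have -> : z - 2^-1 ^+ j * w = 2^-1 ^+ j * (2 ^+ j * z - w).
    by rewrite mulrBr mulrA -exprMn mulVf ?expr1n ?mul1r// pnatr_eq0.
  rewrite normrM powRM//; congr (_ * _).
  rewrite ger0_norm ?exprn_ge0// -[2^-1 ^+ j]powR_mulrn// -[2^-1]powR_inv1// -!powRrM.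
  by rewrite -powR_mulrn ?powR_ge0// -powRrM; congr (_ `^ _); ring.
have [M HM] := rapid_poly n.+2 (rschwartz_rapid sP).
have c1 : \int[leb]_w (`|z - 2^-1 ^+ j * w| `^ mu * P w) @[j --> \oo] --> \int[leb]_w (`|z| `^ mu * P w).
  apply: (@L1_dominated R _ _ (fun w => (1 + `|z|) ^+ n * M * (1 + w ^+ 2)^-1) _ _ _ _).2.
  - move=> j; apply: continuous_measurable_fun; apply: ctsM => //.
    apply: (cts_comp (f := fun w => `|w| `^ mu)); first exact: continuous_powR_norm.
    apply: ctsB; first exact: cts_cst.
    by apply: ctsM; [exact: cts_cst|exact: cts_id].
  - by apply: L1Z; exact: L1_oneDsqrV.
  - move=> j w; have w2 : 0 < 1 + w ^+ 2 by rewrite ltr_pwDl// sqr_ge0.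
    rewrite normrM ger0_norm ?powR_ge0// ler_pdivlMr//.
    have tri : 1 + `|z - 2^-1 ^+ j * w| <= (1 + `|z|) * (1 + `|w|).
      have a1 : `|z - 2^-1 ^+ j * w| <= `|z| + `|w|.
        rewrite (le_trans (ler_normB _ _))// lerD// normrM ger0_norm ?exprn_ge0//.
        by rewrite ler_piMl// exprn_ile1// invf_le1// ler1n.
      have := mulr_ge0 (normr_ge0 z) (normr_ge0 w); lra.
    apply: (@le_trans _ _ (((1 + `|z|) * (1 + `|w|)) ^+ n * `|P w| * (1 + `|w|) ^+ 2)).
      apply: ler_pM.
      + by rewrite mulr_ge0// powR_ge0.
      + by rewrite ltW.
      + rewrite ler_wpM2r//; apply: le_trans (powR_norm_le _) _.
        by apply: lerXn2r => //; rewrite nnegrE ?mulr_ge0// addr_ge0.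
      + by have := normr_ge0 w; rewrite -[X in 1 + X](real_normK (num_real w)); nra.
    rewrite exprMn -!mulrA ler_wpM2l ?exprn_ge0 ?addr_ge0//.
    by rewrite [`|P w| * _]mulrC mulrA -exprD addn2.
  - move=> w; apply: cvgMl.
    apply: (continuous_seq_cvg (f := fun w => `|w| `^ mu) continuous_powR_norm).
    rewrite -[X in _ --> X](subr0 z); apply: cvgB; first exact: cvg_cst.
    rewrite -[X in _ --> X](mul0r w); apply: cvgMl; apply: cvg_expr.
    by rewrite ger0_norm// invf_lt1// ltr1n.
rewrite -RintegralTZ; last exact: rschwartz_L1.
apply: (cvg_unique (@Rhausdorff R) _ c1).
rewrite (_ : (fun j => _) = (fun => homconv P z)); first exact: cvg_cst.
by apply/funext => j; rewrite -H.
Qed.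

(** By [homconv_limit] the convolution is [|z|^mu] times the integral of [P], hence even, so
    [homconv_vanish] is used with parity [false]; there the degree must avoid the even naturals. At
    [z = 1] the vanishing reads off the integral. *)
Lemma homconv_rigidity P : rschwartz P ->
  (~ exists k : int, mu = (2 * k)%:~R) ->
  (forall z, \int[leb]_w (`|w| `^ mu * (2 * P (2 * (z - w)) - P (z - w))) = 0) ->
  \int[leb]_w P w = 0.
Proof.
move=> sP hk h0; have cP := rschwartz_continuous sP.
have two0 : (2 : R) != 0 by rewrite pnatr_eq0.
have hd z : homconv P (2 * z) = 2 `^ mu * homconv P z.
  have Li := homconv_L1 z (rschwartz_rapid sP) cP.
  have sP2 := rschwartzZ 2 (rschwartz_affine 0 two0 sP).
  have Li2 := homconv_L1 z (rschwartz_rapid sP2) (rschwartz_continuous sP2).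
  have : 2 `^ (- mu) * homconv P (2 * z) = homconv P z.
    rewrite -homconv_scale//; apply/eqP; rewrite -subr_eq0; apply/eqP.
    rewrite -RintegralTB//; last first.
      by move: Li2; congr L1; apply/funext => w; rewrite addr0.
    by rewrite -[RHS](h0 z); apply: eq_Rintegral => w _; rewrite [X in _ = X]mulrBr.
  move=> <-; rewrite mulrA powRN mulfV ?mul1r// gt_eqF// powR_gt0//.
have E z := homconv_limit z sP hd.
have := @homconv_vanish n P mu false sP hd _ _ _ 1.
rewrite E normr1 powR1 mul1r; apply.
- by move=> z; rewrite expr0 mul1r !E normrN.
- by rewrite archi_boundP// ltW.
- move=> k ke; apply/eqP => muk; apply: hk; exists (k./2)%:Z.
  by rewrite muk -{1}(odd_double_half k) ke add0n -muln2 mulnC.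
Qed.

End homogeneous_convolution.

(** * Real and imaginary parts; extending a regular tempered distribution to Schwartz functions *)

Section complex_valued_functions.
Context {R : realType}.
Local Notation leb := (@lebesgue_measure R).
Local Notation Re := complex.Re.
Local Notation Im := complex.Im.
Local Notation normc := Normc.normc.
Implicit Types f g h : R -> R.
Local Open Scope complex_scope.

Lemma Re_normc_le (z : R[i]) : `|Re z| <= normc z.
Proof.
case: z => a b /=; rewrite -sqrtr_sqr ler_wsqrtr// lerDl sqr_ge0//.
Qed.

Lemma Im_normc_le (z : R[i]) : `|Im z| <= normc z.
Proof.
case: z => a b /=; rewrite -sqrtr_sqr ler_wsqrtr// lerDr sqr_ge0//.
Qed.

Lemma normc_le_ReIm (z : R[i]) : normc z <= `|Re z| + `|Im z|.
Proof.
case: z => a b /=; rewrite -[leRHS]ger0_norm ?addr_ge0// -sqrtr_sqr.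
rewrite ler_wsqrtr// sqrrD !real_normK ?num_real//.
have := mulr_ge0 (normr_ge0 a) (normr_ge0 b); lra.
Qed.

Lemma normc_ge0 (z : R[i]) : 0 <= normc z.
Proof. by case: z => a b; exact: sqrtr_ge0. Qed.

Lemma normc_real (a : R) : normc a%:C = `|a|.
Proof. by rewrite /= expr0n addr0 sqrtr_sqr. Qed.

Lemma Re_realM (a : R) (z : R[i]) : Re (a%:C * z) = a * Re z.
Proof. by case: z => c d /=; rewrite mul0r subr0. Qed.

Lemma Im_realM (a : R) (z : R[i]) : Im (a%:C * z) = a * Im z.
Proof. by case: z => c d /=; rewrite mul0r addr0. Qed.

Lemma complex_eq (z w : R[i]) : Re z = Re w -> Im z = Im w -> z = w.
Proof. by case: z => a b; case: w => c d /= -> ->. Qed.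

Lemma schwartz_ReIm (f : R -> R[i]) : schwartz f <->
  rschwartz (fun x => Re (f x)) /\ rschwartz (fun x => Im (f x)).
Proof.
split=> [[sf bf]|[[s1 r1] [s2 r2]]].
  split; (split; first by move=> l x; have [] := sf l x).
    move=> l k; have [M HM] := bf k l; exists M => x; apply: le_trans (HM x).
    rewrite ler_wpM2l ?exprn_ge0//; exact: (Re_normc_le (cderiv l f x)).
  move=> l k; have [M HM] := bf k l; exists M => x; apply: le_trans (HM x).
  rewrite ler_wpM2l ?exprn_ge0//; exact: (Im_normc_le (cderiv l f x)).
split; first by move=> l x; split; [exact: s1|exact: s2].
move=> k l; have [M HM] := r1 l k; have [N HN] := r2 l k; exists (M + N) => x.
apply: le_trans (lerD (HM x) (HN x)); rewrite -mulrDr ler_wpM2l ?exprn_ge0//.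
exact: normc_le_ReIm (cderiv l f x).
Qed.

Lemma rtest_test_function (f : R -> R[i]) :
  rtest (fun x => Re (f x)) -> rtest (fun x => Im (f x)) -> test_function f.
Proof.
move=> [s1 [A hA]] [s2 [B hB]]; split; first by move=> l x; split; [exact: s1|exact: s2].
exists (Num.max A B) => x; rewrite gt_max => /andP[? ?].
by apply: complex_eq; rewrite ?hA ?hB.
Qed.

Lemma derive1nD f g l : smooth f -> smooth g ->
  derive1n l (fun x => f x + g x) = fun x => derive1n l f x + derive1n l g x.
Proof.
elim: l f g => [//|l ih] f g sf sg.
rewrite !derive1Sn -ih; [|exact: smooth_derive1..]; congr derive1n.
apply: derive1_is_derive => x.
have := smooth_is_derive x sf; have := smooth_is_derive x sg => ? ?.
exact: is_deriveD.
Qed.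

Lemma derive1nZ c f l : smooth f ->
  derive1n l (fun x => c * f x) = fun x => c * derive1n l f x.
Proof.
elim: l f => [//|l ih] f sf.
rewrite !derive1Sn -ih; last exact: smooth_derive1; congr derive1n.
apply: derive1_is_derive => x.
by have := smooth_is_derive x sf => ?; apply: is_derive_eq; rewrite /GRing.scale/=; ring.
Qed.

(* The weight [1 + |x|] lets the class contain [1 - chi (x / n)], which does
   not tend to [0] uniformly; it is absorbed by the rapidly decreasing factor. *)
Definition vanishing_multiplier (e : nat -> R -> R) := (forall n, smooth (e n)) /\
  forall i, exists A : R, forall n x, `|derive1n i (e n) x| <= A * (1 + `|x|) / n.+1%:R.

(** The induction is over all multipliers and all [f] at once: differentiating either factor stays
    in its class, so the product rule is used once per step. The power [k + 1] of the weight absorbs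
    the factor [1 + |x|] of the multiplier. *)
Lemma vanishing_multiplierM l (e : nat -> R -> R) f k :
  vanishing_multiplier e -> rschwartz f ->
  exists C : R, forall n x, `|x| ^+ k * `|derive1n l (fun y => e n y * f y) x| <= C / n.+1%:R.
Proof.
elim: l e f => [|l ih] e f [se be] sf.
  have [A HA] := be 0; have [M HM] := rapid_poly k.+1 (rschwartz_rapid sf).
  have A0 : 0 <= A.
    have := le_trans (normr_ge0 _) (HA 0 0); rewrite normr0 addr0 mulr1 divr1.
    by [].
  exists (A * M) => n x; rewrite derive1n0 normrM.
  apply: (@le_trans _ _ ((1 + `|x|) ^+ k * ((A * (1 + `|x|) / n.+1%:R) * `|f x|))).
    apply: ler_pM; rewrite ?exprn_ge0 ?mulr_ge0//.
      by apply: lerXn2r; rewrite ?nnegrE ?addr_ge0// lerDr.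
    by rewrite ler_wpM2r// HA.
  apply: (@le_trans _ _ (A / n.+1%:R * ((1 + `|x|) ^+ k.+1 * `|f x|))).
    by rewrite exprSr le_eqVlt; apply/orP; left; apply/eqP; ring.
  by rewrite [leRHS]mulrAC ler_wpM2l// divr_ge0.
have se' : vanishing_multiplier (fun n => derive1 (e n)).
  split=> [n|i]; first exact: smooth_derive1.
  by have [A HA] := be i.+1; exists A => n x; rewrite -derive1Sn.
have [C HC] := ih _ _ se' sf.
have [D HD] := ih _ _ (conj se be) (rschwartz_derive1 sf).
exists (C + D) => n x.
have -> : derive1n l.+1 (fun y => e n y * f y) x =
    derive1n l (fun y => derive1 (e n) y * f y) x + derive1n l (fun y => e n y * derive1 f y) x.
  transitivity (derive1n l (fun y => derive1 (e n) y * f y + e n y * derive1 f y) x); last first.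
    rewrite derive1nD//; apply: smoothM; [|exact: sf.1|exact: se|].
      exact: smooth_derive1.
    exact: smooth_derive1 sf.1.
  rewrite derive1Sn; congr (derive1n l _ x); apply: derive1_is_derive => y.
  have := smooth_is_derive y (se n); have := smooth_is_derive y sf.1 => ? ?.
  by apply: is_derive_eq; rewrite /GRing.scale/=; ring.
rewrite mulrDl; apply: le_trans (lerD (HC n x) (HD n x)).
by rewrite -mulrDr ler_wpM2l ?exprn_ge0// ler_normD.
Qed.

(** At order zero the function vanishes for [|x| <= n + 1], while elsewhere [1 <= |x| / (n + 1)],
    which accounts for the weight. At higher orders the chain rule supplies a factor
    [1 / (n + 1)]. *)
Lemma cutoff_vanishing (a : R -> R) : rtest a -> (forall x, `|x| <= 1 -> a x = 1) ->
  vanishing_multiplier (fun n x => 1 + (-1) * a (n.+1%:R^-1 * x + 0)).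
Proof.
move=> ta a1; have sa := ta.1.
have ss (n : nat) : smooth (fun x => a (n.+1%:R^-1 * x + 0)) by exact: smooth_affine.
have sn (n : nat) : smooth (fun x => (-1) * a (n.+1%:R^-1 * x + 0)).
  by apply: smoothM; [exact: smooth_cst|exact: ss].
split=> [n|i].
  by apply: smoothD; [exact: smooth_cst|exact: sn].
have [B HB] := rapid_bounded ((rtest_rschwartz ta).2 i).
have B0 : 0 <= B by exact: le_trans (HB 0).
have n0 (n : nat) : 0 < (n.+1%:R : R) by rewrite ltr0Sn.
case: i HB => [|i] HB.
  exists (1 + B) => n x; rewrite derive1n0 addr0.
  have [xn|xn] := leP `|x| n.+1%:R.
    rewrite a1; last by rewrite normrM gtr0_norm ?invr_gt0// mulrC ler_pdivrMr// mul1r.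
    by rewrite mulr1 subrr normr0 divr_ge0 ?mulr_ge0 ?addr_ge0.
  apply: (@le_trans _ _ (1 + B)).
    by rewrite (le_trans (ler_normD _ _))// normr1 lerD2l mulN1r normrN.
  rewrite -mulrA ler_peMr ?addr_ge0// ler_pdivlMr// mul1r; lra.
exists B => n x.
have d1 : derive1 (fun x => 1 + (-1) * a (n.+1%:R^-1 * x + 0)) =
    fun x => (- n.+1%:R^-1) * derive1 a (n.+1%:R^-1 * x + 0).
  apply: derive1_is_derive => y; have da := smooth_is_derive (n.+1%:R^-1 * y + 0) sa.
  have := is_derive_affine da => ?.
  by apply: is_derive_eq; rewrite /GRing.scale/=; ring.
rewrite derive1Sn d1 derive1nZ; last by apply: smooth_affine; exact: smooth_derive1.
rewrite derive1n_affine; last exact: smooth_derive1.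
rewrite -derive1Sn normrM normrN normfV (gtr0_norm (n0 n)) [leLHS]mulrC ler_pM2r ?invr_gt0//.
apply: (@le_trans _ _ B); last by rewrite ler_peMr// lerDl.
rewrite normrM (le_trans _ (HB (n.+1%:R^-1 * x + 0)))// ler_piMl//.
rewrite ger0_norm ?exprn_ge0 ?invr_ge0//.
by rewrite exprn_ile1 ?invr_ge0// invf_le1// ler1n.
Qed.

Lemma L1_bounded_mul f g (B : R) : measurable_fun setT f -> (forall x, `|f x| <= B) -> L1 g ->
  L1 (fun x => f x * g x).
Proof.
move=> mf fB gi; apply: (L1_le (g := fun x => B * `|g x|)).
- by apply: measurable_funM => //; exact: L1_measurable.
- by move=> x; rewrite normrM ler_wpM2r.
- by apply: L1Z; exact: L1_norm.
Qed.

Lemma cutoff_cvg (a F g : R -> R) (B : R) : rtest a -> (forall x, `|x| <= 1 -> a x = 1) ->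
  measurable_fun setT F -> (forall x, `|F x| <= B) -> L1 g ->
  \int[leb]_x (F x * (a (n.+1%:R^-1 * x + 0) * g x)) @[n --> \oo] --> \int[leb]_x (F x * g x).
Proof.
move=> ta a1 mF FB gi; have [A HA] := rapid_bounded (rtest_rapid ta).
have ca := smooth_continuous ta.1.
apply: (@L1_dominated R _ _ (fun x => A * `|F x * g x|) _ _ _ _).2.
- move=> n; apply: measurable_funM => //; apply: measurable_funM; last exact: L1_measurable.
  by apply: continuous_measurable_fun; apply: cts_comp => //; exact: cts_affine.
- by apply: L1Z; apply: L1_norm; exact: L1_bounded_mul FB gi.
- by move=> n x; rewrite mulrCA normrM ler_wpM2r.
- move=> x; have cc : continuous (fun t : R => F x * (a (t * x + 0) * g x)).
    apply: ctsM; first exact: cts_cst.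
    apply: ctsM; last exact: cts_cst.
    apply: cts_comp => //; apply: ctsD; last exact: cts_cst.
    by apply: ctsM; [exact: cts_id|exact: cts_cst].
  have := continuous_seq_cvg cc (@cvg_harmonic R).
  by rewrite mul0r addr0 (a1 0) ?normr0// mul1r.
Qed.

Lemma cvg_harmonicM (C : R) : C / n.+1%:R @[n --> \oo] --> (0 : R).
Proof.
rewrite -[X in _ --> X](mulr0 C); apply: cvgMr; exact: cvg_harmonic.
Qed.

Lemma schwartz_seminorm_ge (k l : nat) (x : R) (f : R -> R[i]) : schwartz f ->
  `|x| ^+ k * normc (cderiv l f x) <= schwartz_seminorm k l f.
Proof.
move=> [_ /(_ k l)[M HM]].
apply: ub_le_sup; last by exists x.
by exists M => _ [y _ <-]; exact: HM.
Qed.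

(* [regular_distribution] only tests against compactly supported functions, while
   the convolution kernels are merely Schwartz. *)
Lemma tempered_extension (a : R -> R) (v : (R -> R[i]) -> R[i]) (F : R -> R) (B : R) (phi : R -> R[i]) :
  rtest a -> (forall x, `|x| <= 1 -> a x = 1) ->
  tempered v -> regular_distribution v (fun x => (F x)%:C) ->
  measurable_fun setT F -> (forall x, `|F x| <= B) -> schwartz phi ->
  v phi = cintegral (fun x => (F x)%:C * phi x).
Proof.
move=> ta a1 [lin [N [K bnd]]] [_ reg] mF FB sphi.
have [s1 s2] := (schwartz_ReIm phi).1 sphi.
(* [chi n] is the truncation of [phi], a test function, and [r n = phi - chi n] tends to zero in
   every seminorm. The constant [v phi = v (r n) + v (chi n)] is then computed by passing to the
   limit. *)
pose chi (n : nat) (x : R) : R[i] := (a (n.+1%:R^-1 * x + 0))%:C * phi x.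
pose r (n : nat) (x : R) : R[i] := (-1) * chi n x + phi x.
have n0 (n : nat) : (n.+1%:R^-1 : R) != 0 by rewrite invr_eq0 pnatr_eq0.
have tac (n : nat) : rtest (fun x => a (n.+1%:R^-1 * x + 0)).
  by have := rtest_scale (n0 n) ta; congr rtest; apply/funext => x; rewrite addr0.
have rchi n : rtest (fun x => Re (chi n x)).
  have := rtestM (tac n) s1.1; congr rtest; apply/funext => x.
  by rewrite Re_realM mulrC.
have ichi n : rtest (fun x => Im (chi n x)).
  have := rtestM (tac n) s2.1; congr rtest; apply/funext => x.
  by rewrite Im_realM mulrC.
have schi n : schwartz (chi n).
  by apply/schwartz_ReIm; split; exact: rtest_rschwartz.
have vr n : v (r n) = (-1) * v (chi n) + v phi by exact: lin.
have Rr n : (fun x => Re (r n x)) = (fun x => (1 + (-1) * a (n.+1%:R^-1 * x + 0)) * Re (phi x)).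
  apply/funext => x; rewrite /r /chi; case: (phi x) => p1 p2 /=; ring.
have Ir n : (fun x => Im (r n x)) = (fun x => (1 + (-1) * a (n.+1%:R^-1 * x + 0)) * Im (phi x)).
  apply/funext => x; rewrite /r /chi; case: (phi x) => p1 p2 /=; ring.
have vm := cutoff_vanishing ta a1.
have sr n : schwartz (r n).
  apply/schwartz_ReIm; split.
    have -> : (fun x => Re (r n x)) = (fun x => (-1) * Re (chi n x) + Re (phi x)).
      by apply/funext => x; rewrite /r; case: (chi n x) => ? ?; case: (phi x) => ? ? /=; ring.
    by apply: rschwartzD => //; apply: rschwartzZ; exact: rtest_rschwartz.
  have -> : (fun x => Im (r n x)) = (fun x => (-1) * Im (chi n x) + Im (phi x)).
    by apply/funext => x; rewrite /r; case: (chi n x) => ? ?; case: (phi x) => ? ? /=; ring.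
  by apply: rschwartzD => //; apply: rschwartzZ; exact: rtest_rschwartz.
have semi k l : exists C : R, forall n, schwartz_seminorm k l (r n) <= C / n.+1%:R.
  have [C HC] := @vanishing_multiplierM l _ _ k vm s1.
  have [D HD] := @vanishing_multiplierM l _ _ k vm s2.
  exists (C + D) => n; apply: ge_sup; first by apply: image_nonempty; exists 0.
  move=> _ [x _ <-]; rewrite mulrDl; apply: le_trans (lerD (HC n x) (HD n x)).
  rewrite -mulrDr ler_wpM2l ?exprn_ge0// -Rr -Ir.
  exact: normc_le_ReIm (cderiv l (r n) x).
have [C HC] : exists C : R, forall n, normc (v (r n)) <= C / n.+1%:R.
  have [D HD] : exists D : R, forall n, \sum_(k < N) \sum_(l < N) schwartz_seminorm k l (r n) <= D / n.+1%:R.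
    (* Continuity of [v] involves finitely many seminorms; one constant is chosen for each. *)
    exists (\sum_(k < N) \sum_(l < N) projT1 (cid (semi k l))) => n.
    rewrite mulr_suml; apply: ler_sum => k _; rewrite mulr_suml; apply: ler_sum => l _.
    exact: (projT2 (cid (semi k l))).
  exists (`|K| * D) => n; apply: le_trans (bnd _ (sr n)) _.
  have S0 : 0 <= \sum_(k < N) \sum_(l < N) schwartz_seminorm k l (r n).
    apply: sumr_ge0 => k _; apply: sumr_ge0 => l _.
    apply: le_trans (schwartz_seminorm_ge k l 0 (sr n)).
    by rewrite mulr_ge0 ?exprn_ge0 ?normc_ge0.
  (* The constant [K] comes without a sign, whereas the sum of seminorms is nonnegative. *)
  apply: (@le_trans _ _ (`|K| * \sum_(k < N) \sum_(l < N) schwartz_seminorm k l (r n))).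
    by rewrite ler_wpM2r// ler_norm.
  by rewrite -mulrA ler_wpM2l.
have vE n : v phi = v (r n) + v (chi n) by rewrite vr; ring.
have z1 : Re (v (r n)) @[n --> \oo] --> (0 : R).
  apply/norm_cvg0P; apply: (@squeeze_cvgr _ _ _ _ (fun=> 0) (fun n : nat => C / n.+1%:R)).
  - by apply: nearW => n; rewrite normr_ge0/= (le_trans (Re_normc_le _)).
  - exact: cvg_cst.
  - exact: cvg_harmonicM.
have z2 : Im (v (r n)) @[n --> \oo] --> (0 : R).
  apply/norm_cvg0P; apply: (@squeeze_cvgr _ _ _ _ (fun=> 0) (fun n : nat => C / n.+1%:R)).
  - by apply: nearW => n; rewrite normr_ge0/= (le_trans (Im_normc_le _)).
  - exact: cvg_cst.
  - exact: cvg_harmonicM.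
have vchi n := reg (chi n) (rtest_test_function (rchi n) (ichi n)).
apply: complex_eq.
- have c1 := cutoff_cvg ta a1 mF FB (rschwartz_L1 s1).
  have c2 : Re (v (r n)) + \int[leb]_x (F x * (a (n.+1%:R^-1 * x + 0) * Re (phi x)))
      @[n --> \oo] --> 0 + \int[leb]_x (F x * Re (phi x)).
    exact: cvgD.
  rewrite add0r in c2.
  transitivity (\int[leb]_x (F x * Re (phi x))); last first.
    by rewrite /cintegral/=; apply: eq_Rintegral => x _; rewrite Re_realM.
  apply: (cvg_unique (@Rhausdorff R) _ c2).
  rewrite (_ : (fun n => _) = (fun => Re (v phi))); first exact: cvg_cst.
  apply/funext => n /=; rewrite (vE n) vchi.
  case: (v (r n)) => p1 p2 /=; congr (_ + _); apply: eq_Rintegral => x _.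
  by rewrite !Re_realM.
- have c1 := cutoff_cvg ta a1 mF FB (rschwartz_L1 s2).
  have c2 : Im (v (r n)) + \int[leb]_x (F x * (a (n.+1%:R^-1 * x + 0) * Im (phi x)))
      @[n --> \oo] --> 0 + \int[leb]_x (F x * Im (phi x)).
    exact: cvgD.
  rewrite add0r in c2.
  transitivity (\int[leb]_x (F x * Im (phi x))); last first.
    by rewrite /cintegral/=; apply: eq_Rintegral => x _; rewrite Im_realM.
  apply: (cvg_unique (@Rhausdorff R) _ c2).
  rewrite (_ : (fun n => _) = (fun => Im (v phi))); first exact: cvg_cst.
  apply/funext => n /=; rewrite (vE n) vchi.
  case: (v (r n)) => p1 p2 /=; congr (_ + _); apply: eq_Rintegral => x _.
  by rewrite !Im_realM.
Qed.

End complex_valued_functions.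

(** * Finiteness of weighted norms; convolutions with disjoint spectra *)

Section weighted_norm.
Context {R : realType}.
Local Notation leb := (@lebesgue_measure R).
Local Notation Re := complex.Re.
Local Notation Im := complex.Im.
Local Notation normc := Normc.normc.
Implicit Types f g h k : R -> R.

Lemma powR_continuous_pos (r x : R) : 0 < x -> {for x, continuous (fun y : R => y `^ r)}.
Proof. by move=> x0; exact: (is_derive_continuous (is_derive1_powR r x0)). Qed.

(** For [alpha < 0] the power blows up at [0]. The fundamental theorem is applied away from [0],
    with a bound independent of [n] that monotone convergence carries to []0, 1]]. *)
Lemma integral_powR_le (alpha : R) (n : nat) : -1 < alpha ->
  (\int[leb]_(x in `[(n.+1%:R^-1)%R, 1%R]) (x `^ alpha)%:E <= ((1 + alpha)^-1)%:E)%E.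
Proof.
move=> al; have a1 : 0 < 1 + alpha by lra.
(* For [n = 0] the interval degenerates to the point [1]. *)
case: n => [|n].
  by rewrite invr1 set_itv1 integral_set1 lee_fin invr_ge0 ltW.
have n1 : (0 : R) < n.+2%:R^-1 by rewrite invr_gt0.
have n2 : n.+2%:R^-1 < 1 :> R by rewrite invf_lt1// ltr1n.
pose F (x : R) : R := (1 + alpha)^-1 * x `^ (1 + alpha).
have dF (x : R) : 0 < x -> is_derive x (1 : R) F (x `^ alpha).
  move=> x0; have := is_derive1_powR (1 + alpha) x0 => ?.
  apply: is_derive_eq; rewrite /GRing.scale/= [1 + alpha - 1]addrC addKr.
  by rewrite mulKf// gt_eqF.
rewrite (@continuous_FTC2 _ _ F)//.
- rewrite -EFinB lee_fin /F powR1 mulr1 gerDl oppr_le0 mulr_ge0 ?powR_ge0//.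
  by rewrite invr_ge0 ltW.
- apply: continuous_in_subspaceT => x; rewrite inE/= in_itv/= => /andP[nx _].
  by apply: powR_continuous_pos; exact: lt_le_trans nx.
- split.
  + move=> x; rewrite in_itv/= => /andP[nx _].
    by have := dF x (lt_trans n1 nx) => ?; exact: ex_derive.
  + by apply: cvg_at_right_filter; exact: (is_derive_continuous (dF _ n1)).
  + by apply: cvg_at_left_filter; exact: (is_derive_continuous (dF _ ltr01)).
- move=> x; rewrite in_itv/= => /andP[nx _]; rewrite derive1E.
  by have := dF x (lt_trans n1 nx) => ?; exact: derive_val.
Qed.

Lemma L1_powR_itv (alpha : R) : -1 < alpha ->
  L1 ((fun x : R => x `^ alpha) \_ `]0, 1]%classic).
Proof.
move=> al; rewrite /L1 -restrict_EFin.
have mp : measurable_fun setT (fun x : R => (x `^ alpha)%:E).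
  by apply/measurable_EFinP; exact: measurable_powR.
suff : leb.-integrable `]0%R, 1%R]%classic (EFin \o (fun x : R => x `^ alpha)).
  by move=> I; apply/(@integrable_mkcond _ _ _ leb `]0%R, 1%R]%classic) => //.
apply/integrableP; split; first exact: (measurable_funTS mp).
under eq_integral do rewrite /= ger0_norm ?powR_ge0//.
have U : `]0%R, 1%R]%classic = \bigcup_n `[(n.+1%:R^-1)%R, 1%R]%classic :> set R.
  apply/seteqP; split => x /=.
    rewrite in_itv/= => /andP[x0 x1]; exists (Num.bound x^-1) => //=.
    rewrite in_itv/= x1 andbT invf_ple ?posrE// ltW// (lt_le_trans (archi_boundP _))//.
      by rewrite invr_ge0 ltW.
    by rewrite ler_nat.
  by move=> [n _] /=; rewrite !in_itv/= => /andP[nx ->]; rewrite andbT (lt_le_trans _ nx)// invr_gt0.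
rewrite U; apply: (@le_lt_trans _ _ ((1 + alpha)^-1)%:E); last exact: ltry.
have cv := @ge0_nondecreasing_set_cvg_integral _ (measurableTypeR R) R
  (fun n : nat => `[(n.+1%:R^-1)%R, 1%R]%classic) (fun x => (x `^ alpha)%:E) leb.
have {}cv : (\int[leb]_(x in `[(i.+1%:R^-1)%R, 1%R]) (x `^ alpha)%:E)%E @[i --> \oo] -->
    (\int[leb]_(x in \bigcup_i `[(i.+1%:R^-1)%R, 1%R]%classic) (x `^ alpha)%:E)%E.
  apply: cv => //.
  - move=> m n mn; rewrite subsetEset => x /=; rewrite !in_itv/= => /andP[mx ->].
    by rewrite andbT (le_trans _ mx)// lef_pV2 ?posrE// ler_nat.
  - by move=> n; exact: (measurable_funTS mp).
  - by move=> n x _; rewrite lee_fin powR_ge0.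
rewrite -(cvg_lim _ cv)//; apply: lime_le; first by apply: cvgP cv.
by apply: nearW => n; exact: integral_powR_le.
Qed.

(** Near the origin [g] is bounded and the weight is integrable because [alpha > -1]; at infinity
    the rapid decay of [g] beats the growth of the weight. *)
Lemma weighted_Lp_norm_lty (p alpha : R) (g : R -> R[i]) : 1 <= p -> -1 < alpha ->
  continuous (fun x => Re (g x)) -> continuous (fun x => Im (g x)) ->
  rapid (fun x => Re (g x)) -> rapid (fun x => Im (g x)) ->
  (weighted_Lp_norm p alpha g < +oo)%E.
Proof.
move=> p1 al c1 c2 r1 r2; apply: poweR_lty.
have p0 : 0 <= p by lra.
pose m := Num.bound `|alpha|.
have [M1 H1] := rapid_poly m.+2 r1; have [M2 H2] := rapid_poly m.+2 r2.
have HM x : (1 + `|x|) ^+ m.+2 * normc (g x) <= M1 + M2.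
  apply: le_trans (lerD (H1 x) (H2 x)); rewrite -mulrDr ler_wpM2l ?exprn_ge0 ?addr_ge0//.
  exact: normc_le_ReIm.
pose M := M1 + M2; pose W := (fun x : R => x `^ alpha) \_ `]0, 1]%classic.
have Wi := L1_powR_itv al.
have n1 : (-1 : R) != 0 by rewrite oppr_eq0 oner_eq0.
have Wi' := integrable_affine 0 n1 Wi.
have W0 x : 0 <= W x by rewrite /W patchE; case: ifP => // _; exact: powR_ge0.
have M0 : 0 <= M by apply: le_trans (HM 0); rewrite mulr_ge0 ?exprn_ge0 ?addr_ge0 ?normc_ge0.
(* [W] and its reflection dominate the weight on either side of [0], and the last summand controls
   [|x| > 1]. *)
pose D x := M `^ p * (W x + W (-1 * x + 0) + (1 + x ^+ 2)^-1).
have Di : L1 D by apply: L1Z; apply: L1D; [exact: L1D|exact: L1_oneDsqrV].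
have key x : normc (g x) `^ p * `|x| `^ alpha <= D x.
  have i2 : 0 < 1 + x ^+ 2 by rewrite ltr_pwDl// sqr_ge0.
  have xge : 1 <= 1 + `|x| by rewrite lerDl.
  have xm : 1 <= (1 + `|x|) ^+ m.+2 by exact: exprn_ege1.
  have gM : normc (g x) <= M.
    by apply: le_trans (HM x); rewrite ler_peMl ?normc_ge0.
  have gMp : normc (g x) `^ p <= M `^ p.
    by apply: ge0_ler_powR => //; rewrite nnegrE ?normc_ge0.
  have [x1|x1] := leP `|x| 1.
    apply: ler_pM; rewrite ?powR_ge0//.
    have [->|x0] := eqVneq x 0.
      have e : (1 + 0 ^+ 2 : R)^-1 = 1 by rewrite expr0n addr0 invr1.
      rewrite normr0 e (le_trans (_ : _ <= 1))//; last by rewrite lerDr addr_ge0.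
      (* At the origin [0^alpha] is [0], or [1] when [alpha = 0]; the last summand of [D] covers
         both values. *)
      by have [->|a0] := eqVneq alpha 0; rewrite ?powRr0 ?powR0.
    have [xp|xn] := ltP 0 x.
      rewrite gtr0_norm// in x1 *; rewrite -addrA {1}/W patchE ifT.
        by rewrite lerDl addr_ge0// invr_ge0 ltW.
      by rewrite inE/= in_itv/= xp.
    rewrite ler0_norm// in x1 *; rewrite mulN1r addr0 [W x + _]addrC -addrA {1}/W patchE ifT.
      by rewrite lerDl addr_ge0// invr_ge0 ltW.
    by rewrite inE/= in_itv/= x1 andbT oppr_gt0 lt_neqAle x0.
  have x0 : 0 < 1 + `|x| by rewrite ltr_pwDl.
  apply: (@le_trans _ _ (M `^ p * (1 + x ^+ 2)^-1)); last first.
    by rewrite ler_wpM2l ?powR_ge0// lerDr addr_ge0.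
  have gN : normc (g x) <= M * ((1 + `|x|) ^+ m.+2)^-1.
    by rewrite ler_pdivlMr ?exprn_gt0// mulrC.
  have a1 : normc (g x) `^ p <= M `^ p * ((1 + `|x|) ^+ m.+2)^-1.
    apply: (@le_trans _ _ ((M * ((1 + `|x|) ^+ m.+2)^-1) `^ p)).
      apply: ge0_ler_powR => //; rewrite nnegrE ?normc_ge0//.
      by rewrite mulr_ge0// invr_ge0 ltW// exprn_gt0.
    rewrite powRM// ?invr_ge0 ?(ltW (exprn_gt0 _ _))//.
    (* The decay factor lies in []0, 1]], so raising it to the power [p >= 1] only decreases it. *)
    rewrite ler_wpM2l ?powR_ge0//; apply: ge1r_powR => //.
    by rewrite invr_gt0 exprn_gt0//= invf_le1// exprn_gt0.
  have a2 : `|x| `^ alpha <= (1 + `|x|) ^+ m.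
    rewrite -powR_mulrn ?addr_ge0//.
    apply: (@le_trans _ _ (`|x| `^ m%:R)).
      apply: ler_powR; first exact: ltW.
      by rewrite (le_trans (ler_norm _))// ltW// archi_boundP.
    by apply: ge0_ler_powR; rewrite ?nnegrE ?ler0n ?addr_ge0// lerDr.
  apply: (@le_trans _ _ (M `^ p * ((1 + `|x|) ^+ m.+2)^-1 * (1 + `|x|) ^+ m)).
    by apply: ler_pM; rewrite ?powR_ge0.
  rewrite -mulrA ler_wpM2l ?powR_ge0// -addn2 exprD invfM mulrAC mulVf ?mul1r; last first.
    by rewrite expf_neq0// gt_eqF.
  rewrite lef_pV2 ?posrE ?exprn_gt0//.
  by have := normr_ge0 x; rewrite -[X in 1 + X](real_normK (num_real x)); nra.
apply: (@le_lt_trans _ _ (\int[leb]_x (D x)%:E)%E).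
  apply: ge0_le_integral => //.
  - by move=> x _; rewrite lee_fin mulr_ge0 ?powR_ge0.
  - apply/measurable_EFinP; apply: measurable_funM.
      apply: (measurableT_comp (f := fun y => y `^ p)); first exact: measurable_powR.
      rewrite (_ : (fun x => normc (g x)) = (fun x => Num.sqrt (Re (g x) ^+ 2 + Im (g x) ^+ 2))); last first.
        by apply/funext => x; case: (g x).
      apply: continuous_measurable_fun; apply: cts_comp; first exact: sqrt_continuous.
      by apply: ctsD; apply: ctsM.
    apply: (measurableT_comp (f := fun y => y `^ alpha)); first exact: measurable_powR.
    exact: normr_measurable.
  - by apply/measurable_EFinP; exact: L1_measurable.
  - by move=> x _; rewrite lee_fin.
have := integrable_fin_num measurableT Di.
by rewrite fin_numElt => /andP[].
Qed.

(** The inequality [1 + |x| <= (1 + |y|) (1 + |x - y|)] shares the weight between the two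
    factors. *)
Lemma convolution_rapid f k : rschwartz f -> rschwartz k ->
  rapid (fun x => \int[leb]_y (f y * k (x - y))).
Proof.
move=> sf sk; apply: poly_rapid => n.
have [M HM] := rapid_poly n (rschwartz_rapid sk).
have mf := rschwartz_measurable sf; have ck := rschwartz_continuous sk.
have mp : measurable_fun setT (fun y : R => (1 + `|y|) ^+ n).
  by apply: measurable_funX; apply: measurable_funD => //; exact: normr_measurable.
have Gi : L1 (fun y => (1 + `|y|) ^+ n * `|f y|).
  have := L1_norm (rapid_L1M (n := n) mf mp (rschwartz_rapid sf) _).
  move=> H; have := H _; rewrite {H} => H.
  have : L1 (fun y => `|(1 + `|y|) ^+ n * f y|).
    by apply: H => y; rewrite ger0_norm// exprn_ge0// addr_ge0.
  by congr L1; apply/funext => y; rewrite normrM ger0_norm.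
have fki x : L1 (fun y => f y * k (x - y)).
  have [B HB] := rapid_bounded (rschwartz_rapid sk).
  have := @L1_bounded_mul R (fun y => k (x - y)) f B _ (fun y => HB _) (rschwartz_L1 sf).
  move=> H; have : L1 (fun y => k (x - y) * f y).
    apply: H; apply: continuous_measurable_fun; apply: cts_comp => //.
    by apply: ctsB; [exact: cts_cst|exact: cts_id].
  by congr L1; apply/funext => y; rewrite mulrC.
exists (\int[leb]_y (M * ((1 + `|y|) ^+ n * `|f y|))) => x.
have p0 : 0 <= (1 + `|x|) ^+ n by rewrite exprn_ge0// addr_ge0.
rewrite -[X in X * _](ger0_norm p0) -normrM -RintegralTZ//.
apply: L1_norm_le; first exact: L1Z.
  by apply: L1_measurable; exact: L1Z.
move=> y; rewrite !normrM (ger0_norm p0).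
apply: (@le_trans _ _ (((1 + `|y|) * (1 + `|x - y|)) ^+ n * (`|f y| * `|k (x - y)|))).
  rewrite ler_wpM2r ?mulr_ge0//; apply: lerXn2r; rewrite ?nnegrE ?mulr_ge0 ?addr_ge0//.
  have := ler_normD (x - y) y; rewrite subrK.
  have := mulr_ge0 (normr_ge0 y) (normr_ge0 (x - y)); lra.
rewrite exprMn; apply: (@le_trans _ _ ((1 + `|y|) ^+ n * `|f y| * ((1 + `|x - y|) ^+ n * `|k (x - y)|))).
  by rewrite le_eqVlt; apply/orP; left; apply/eqP; ring.
by rewrite [leRHS]mulrC ler_wpM2l// mulr_ge0 ?exprn_ge0 ?addr_ge0.
Qed.

Lemma convolution_continuous f k : rschwartz f -> rschwartz k ->
  continuous (fun x => \int[leb]_y (f y * k (x - y))).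
Proof.
move=> sf sk; have [M HM] := rapid_bounded (rschwartz_rapid sk).
have cf := rschwartz_continuous sf; have ck := rschwartz_continuous sk.
apply: (@continuous_Rintegral R (fun x y => f y * k (x - y)) (fun y => M * `|f y|)).
- move=> x; apply: continuous_measurable_fun; apply: ctsM => //.
  by apply: cts_comp => //; apply: ctsB; [exact: cts_cst|exact: cts_id].
- move=> y; apply: ctsM; first exact: cts_cst.
  by apply: cts_comp => //; apply: ctsB; [exact: cts_id|exact: cts_cst].
- by apply: L1Z; apply: L1_norm; exact: rschwartz_L1.
- by move=> x y; rewrite normrM mulrC ler_wpM2r.
Qed.

(** By Fubini the convolution is a superposition of the frequencies [eta] of [h]; where [h eta] is
    nonzero, [trigT_orthogonal] kills the component. Vanishing is asked at both [eta] and [- eta]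
    because a sine wave carries both frequencies. *)
Lemma convolution_sinT_eq0 (g1 g2 h : R -> R) (x : R) : rtest g1 -> rtest g2 -> rtest h ->
  (forall eta, h eta != 0 -> [/\ g1 eta = 0, g1 (- eta) = 0, g2 eta = 0 & g2 (- eta) = 0]) ->
  \int[leb]_y (sinT h y * (cosT g1 (x - y) + sinT g2 (x - y))) = 0.
Proof.
move=> t1 t2 th hg; have hi := rtest_L1 th.
have sk := trigT_rschwartz t1 t2; have ki := rschwartz_L1 sk.
have ck := rschwartz_continuous sk; have ch := smooth_continuous th.1.
have csh := rschwartz_continuous (sinT_rschwartz th).
pose k y := cosT g1 y + sinT g2 y.
have Fi : L1 (fun y => sinT h (x - y) * k y).
  apply: (@L1_bounded_mul R _ _ (\int[leb]_xi `|h xi|)) => //.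
    apply: continuous_measurable_fun; apply: cts_comp => //.
    by apply: ctsB; [exact: cts_cst|exact: cts_id].
  by move=> y; exact: sinT_norm_le.
transitivity (\int[leb]_y (sinT h (x - y) * k y)).
  rewrite -(Rintegral_sub_var x Fi).
  by apply: eq_Rintegral => y _; rewrite subKr.
transitivity (\int[leb]_y (\int[leb]_eta (sin ((x - y) * eta) * h eta * k y))).
  by apply: eq_Rintegral => y _; rewrite RintegralZr//; exact: L1_sinM.
rewrite (@Rintegral_Fubini R _ k h)//; last 2 first.
- have mfst : measurable_fun [set: R * R] (fun z : R * R => z.1) by exact: measurable_fst.
  have msnd : measurable_fun [set: R * R] (fun z : R * R => z.2) by exact: measurable_snd.
  apply: measurable_funM; first apply: measurable_funM.
  + apply: (measurableT_comp (f := sin)).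
      exact: continuous_measurable_fun (@continuous_sin R).
    by apply: measurable_funM => //; exact: measurable_funB.
  + by have := measurableT_comp (L1_measurable hi) msnd.
  + by have := measurableT_comp (L1_measurable ki) mfst.
- move=> y eta; rewrite !normrM [leRHS]mulrC ler_wpM2r// ler_piMl//.
  exact: sin_norm_le1.
(* Zero is rewritten as an integral over the line, so that the integrands can be compared at each
   frequency. *)
rewrite -[RHS](Rintegral_set0 leb (fun=> 0)) [RHS]Rintegral_mkcond.
apply: eq_Rintegral => eta _; rewrite patchE ifF; last by apply/negP; rewrite inE.
have [h0|h0] := eqVneq (h eta) 0.
  under eq_Rintegral do rewrite h0 mulr0 mul0r.
  by rewrite Rintegral_cst// mul0r.
have [e1 e2 e3 e4] := hg eta h0.
have := trigT_orthogonal x t1 t2 e1 e2 e3 e4 => e.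
transitivity (\int[leb]_y (h eta * (k y * sin ((x - y) * eta)))).
  by apply: eq_Rintegral => y _; ring.
rewrite RintegralTZ ?e ?mulr0//; apply: L1_Mbdd => // [|y]; last exact: sin_norm_le1.
apply: cts_comp; first exact: continuous_sin.
by apply: ctsM; [apply: ctsB; [exact: cts_cst|exact: cts_id]|exact: cts_cst].
Qed.

End weighted_norm.

(** * The convolution kernels of the resolution of unity and the band-limited witness *)

Section dyadic_kernels.
Context {R : realType}.
Local Notation leb := (@lebesgue_measure R).
Local Notation Re := complex.Re.
Local Notation Im := complex.Im.
Local Notation normc := Normc.normc.
Implicit Types f g h k : R -> R.
Local Open Scope complex_scope.

Definition fourier_factor : R := (Num.sqrt (2 * pi))^-1.

Lemma fourier_factor_gt0 : 0 < fourier_factor.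
Proof. by rewrite invr_gt0 sqrtr_gt0 mulr_gt0// pi_gt0. Qed.

Lemma Re_inv_fourier (g : R -> R[i]) (x : R) :
  L1 (fun xi => Re (g xi)) -> L1 (fun xi => Im (g xi)) ->
  Re (inv_fourier g x) = fourier_factor *
    (cosT (fun xi => Re (g xi)) x - sinT (fun xi => Im (g xi)) x).
Proof.
move=> g1 g2; rewrite /inv_fourier Re_realM; congr (_ * _).
rewrite /cintegral /= /cosT /sinT -RintegralTB; [|exact: L1_cosM|exact: L1_sinM].
by apply: eq_Rintegral => xi _; case: (g xi).
Qed.

Lemma Im_inv_fourier (g : R -> R[i]) (x : R) :
  L1 (fun xi => Re (g xi)) -> L1 (fun xi => Im (g xi)) ->
  Im (inv_fourier g x) = fourier_factor *
    (cosT (fun xi => Im (g xi)) x + sinT (fun xi => Re (g xi)) x).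
Proof.
move=> g1 g2; rewrite /inv_fourier Im_realM; congr (_ * _).
rewrite /cintegral /= /cosT /sinT -RintegralTD; [|exact: L1_cosM|exact: L1_sinM].
by apply: eq_Rintegral => xi _; case: (g xi) => /= c d.
Qed.

(** Constant and sign move into the amplitudes, giving the form [cosT g + sinT h] to which
    [trigT_rschwartz] and [convolution_sinT_eq0] apply. *)
Lemma Re_inv_fourier_trig (g : R -> R[i]) (x : R) :
  L1 (fun xi => Re (g xi)) -> L1 (fun xi => Im (g xi)) ->
  Re (inv_fourier g x) = cosT (fun xi => fourier_factor * Re (g xi)) x +
    sinT (fun xi => - fourier_factor * Im (g xi)) x.
Proof. by move=> g1 g2; rewrite Re_inv_fourier// cosTZ// sinTZ//; ring. Qed.

Lemma Im_inv_fourier_trig (g : R -> R[i]) (x : R) :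
  L1 (fun xi => Re (g xi)) -> L1 (fun xi => Im (g xi)) ->
  Im (inv_fourier g x) = cosT (fun xi => fourier_factor * Im (g xi)) x +
    sinT (fun xi => fourier_factor * Re (g xi)) x.
Proof. by move=> g1 g2; rewrite Im_inv_fourier// cosTZ// sinTZ//; ring. Qed.

Lemma inv_fourier_rschwartz (g : R -> R[i]) :
  rtest (fun xi => Re (g xi)) -> rtest (fun xi => Im (g xi)) ->
  rschwartz (fun x => Re (inv_fourier g x)) /\ rschwartz (fun x => Im (inv_fourier g x)).
Proof.
move=> t1 t2; have i1 := rtest_L1 t1; have i2 := rtest_L1 t2; split.
  rewrite (_ : (fun x => _) = (fun x => cosT (fun xi => fourier_factor * Re (g xi)) x +
    sinT (fun xi => - fourier_factor * Im (g xi)) x)).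
    by apply: trigT_rschwartz; exact: rtestZ.
  by apply/funext => x; exact: Re_inv_fourier_trig.
rewrite (_ : (fun x => _) = (fun x => cosT (fun xi => fourier_factor * Im (g xi)) x +
    sinT (fun xi => fourier_factor * Re (g xi)) x)).
  by apply: trigT_rschwartz; exact: rtestZ.
by apply/funext => x; exact: Im_inv_fourier_trig.
Qed.

Lemma schwartz_reflect (K : R -> R[i]) (x : R) :
  rschwartz (fun x => Re (K x)) -> rschwartz (fun x => Im (K x)) ->
  schwartz (fun y => K (x - y)).
Proof.
have n1 : (-1 : R) != 0 by rewrite oppr_eq0 oner_eq0.
move=> s1 s2; apply/schwartz_ReIm; split.
  have := rschwartz_affine x n1 s1; congr rschwartz; apply/funext => y.
  by rewrite mulN1r addrC.
have := rschwartz_affine x n1 s2; congr rschwartz; apply/funext => y.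
by rewrite mulN1r addrC.
Qed.

Definition regular_functional f (phi : R -> R[i]) : R[i] :=
  cintegral (fun y => (f y)%:C * phi y).

Lemma Re_regular_functional f (phi : R -> R[i]) :
  Re (regular_functional f phi) = \int[leb]_y (f y * Re (phi y)).
Proof. by apply: eq_Rintegral => y _; rewrite Re_realM. Qed.

Lemma Im_regular_functional f (phi : R -> R[i]) :
  Im (regular_functional f phi) = \int[leb]_y (f y * Im (phi y)).
Proof. by apply: eq_Rintegral => y _; rewrite Im_realM. Qed.

Lemma rschwartz_prod_L1 f g : L1 f -> rschwartz g -> L1 (fun y => f y * g y).
Proof.
move=> fi sg; have [B HB] := rapid_bounded (rschwartz_rapid sg).
have := L1_bounded_mul (rschwartz_measurable sg) HB fi; congr L1.
by apply/funext => y; rewrite mulrC.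
Qed.

Lemma tempered_regular_functional f : L1 f -> tempered (regular_functional f).
Proof.
move=> fi; split.
  move=> a phi chi sp sc; have [p1 p2] := (schwartz_ReIm phi).1 sp.
  have [c1 c2] := (schwartz_ReIm chi).1 sc.
  have i1 := rschwartz_prod_L1 fi p1; have i2 := rschwartz_prod_L1 fi p2.
  have i3 := rschwartz_prod_L1 fi c1; have i4 := rschwartz_prod_L1 fi c2.
  apply: complex_eq.
    transitivity (\int[leb]_y ((Re a * (f y * Re (phi y)) - Im a * (f y * Im (phi y))) + f y * Re (chi y))).
      rewrite Re_regular_functional; apply: eq_Rintegral => y _.
      by case: (a) => a1 a2; case: (phi y) => ? ?; case: (chi y) => ? ? /=; ring.
    rewrite RintegralTD//; last by apply: L1B; exact: L1Z.
    rewrite RintegralTB; [|exact: L1Z..].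
    rewrite !RintegralTZ// -!Re_regular_functional -!Im_regular_functional.
    by case: (a) => a1 a2; case: (regular_functional f phi) => ? ?; case: (regular_functional f chi).
  transitivity (\int[leb]_y ((Re a * (f y * Im (phi y)) + Im a * (f y * Re (phi y))) + f y * Im (chi y))).
    rewrite Im_regular_functional; apply: eq_Rintegral => y _.
    by case: (a) => a1 a2; case: (phi y) => ? ?; case: (chi y) => ? ? /=; ring.
  rewrite RintegralTD//; last by apply: L1D; exact: L1Z.
  rewrite RintegralTD; [|exact: L1Z..].
  rewrite !RintegralTZ// -!Re_regular_functional -!Im_regular_functional.
  by case: (a) => a1 a2; case: (regular_functional f phi) => ? ?; case: (regular_functional f chi).
(* The sup norm alone suffices, hence [N = 1]; the factor [2] comes from bounding real and imaginary
   parts separately. *)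
exists 1, (2 * \int[leb]_y `|f y|) => phi sp; rewrite !big_ord1.
have [p1 p2] := (schwartz_ReIm phi).1 sp.
have ub y : normc (phi y) <= schwartz_seminorm 0 0 phi.
  have := schwartz_seminorm_ge 0 0 y sp; rewrite expr0 mul1r; apply: le_trans.
  by rewrite /cderiv !derive1n0; case: (phi y).
have fn := L1_norm fi.
have b1 : `|Re (regular_functional f phi)| <= schwartz_seminorm 0 0 phi * \int[leb]_y `|f y|.
  rewrite Re_regular_functional -RintegralTZ//; apply: L1_norm_le; first exact: L1Z.
    by apply: L1_measurable; exact: rschwartz_prod_L1.
  by move=> y; rewrite normrM mulrC ler_wpM2r// (le_trans (Re_normc_le _)).
have b2 : `|Im (regular_functional f phi)| <= schwartz_seminorm 0 0 phi * \int[leb]_y `|f y|.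
  rewrite Im_regular_functional -RintegralTZ//; apply: L1_norm_le; first exact: L1Z.
    by apply: L1_measurable; exact: rschwartz_prod_L1.
  by move=> y; rewrite normrM mulrC ler_wpM2r// (le_trans (Im_normc_le _)).
apply: le_trans (normc_le_ReIm _) _; apply: le_trans (lerD b1 b2) _.
by rewrite le_eqVlt; apply/orP; left; apply/eqP; ring.
Qed.

Lemma regular_functional_distribution f : L1 f ->
  regular_distribution (regular_functional f) (fun x => (f x)%:C).
Proof.
move=> fi; split => //; split; first exact: open_integrable_locally openT fi.
apply: open_integrable_locally openT _.
have := L1Z 0 fi; congr (_.-integrable _ _); apply/funext => x /=.
by rewrite mul0r.
Qed.

Section generator.
Context (psi : R -> R[i]) (hpsi : resolution_generator psi).

(** Real and imaginary parts of [psi]; the latter vanishes for [|x| <= 1] and [|x| >= 3 / 2], but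
    need not vanish in between. *)
Let a (x : R) : R := Re (psi x).
Let b (x : R) : R := Im (psi x).

Lemma generator_rtest : rtest a /\ rtest b.
Proof.
have [sp _ p0] := hpsi; have [s1 s2] := (schwartz_ReIm psi).1 sp.
split; split.
- exact: s1.1.
- by exists (3 / 2) => x hx; rewrite /a p0// ltW.
- exact: s2.1.
- by exists (3 / 2) => x hx; rewrite /b p0// ltW.
Qed.

Lemma generator_eq1 x : `|x| <= 1 -> a x = 1.
Proof. by have [_ p1 _] := hpsi => hx; rewrite /a p1. Qed.

Lemma generator_eq0 x : 3 / 2 <= `|x| -> a x = 0 /\ b x = 0.
Proof. by have [_ _ p0] := hpsi => hx; rewrite /a /b p0. Qed.

(** Stated for an additive [g] so as to serve [Re] and [Im] alike; writing both dilations as [2^-m]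
    exposes the telescoping. *)
Lemma dyadic_psiE (g : R[i] -> R) (gB : {morph g : x y / x - y}) (i : nat) (xi : R) :
  g (dyadic psi i.+1 xi) = g (psi (2 ^- i.+1 * xi)) - g (psi (2 ^- i * xi)).
Proof.
rewrite /= gB; congr (g (psi _) - g (psi _)); last by rewrite mulrC.
by rewrite exprSr invfM [RHS]mulrC mulrA.
Qed.

Lemma Re_dyadicS (i : nat) (xi : R) :
  Re (dyadic psi i.+1 xi) = a (2 ^- i.+1 * xi) - a (2 ^- i * xi).
Proof. by rewrite dyadic_psiE// => -[? ?] [? ?]. Qed.

Lemma Im_dyadicS (i : nat) (xi : R) :
  Im (dyadic psi i.+1 xi) = b (2 ^- i.+1 * xi) - b (2 ^- i * xi).
Proof. by rewrite dyadic_psiE// => -[? ?] [? ?]. Qed.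

Lemma two_expV_neq0 (i : nat) : (2 ^- i : R) != 0.
Proof. by rewrite invr_eq0 expf_neq0// pnatr_eq0. Qed.

Lemma dyadic_rtest j :
  rtest (fun xi => Re (dyadic psi j xi)) /\ rtest (fun xi => Im (dyadic psi j xi)).
Proof.
have [ta tb] := generator_rtest.
have D g : rtest g -> forall i : nat, rtest (fun xi => g (2 ^- i.+1 * xi) + (-1) * g (2 ^- i * xi)).
  move=> tg i; apply: rtestD; first by apply: rtest_scale => //; exact: two_expV_neq0.
  by apply: rtestZ; apply: rtest_scale => //; exact: two_expV_neq0.
case: j => [|i]; first by split.
split.
  have := D _ ta i; congr rtest; apply/funext => xi.
  by rewrite Re_dyadicS mulN1r.
have := D _ tb i; congr rtest; apply/funext => xi.
by rewrite Im_dyadicS mulN1r.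
Qed.

(** For [j >= 2] both dilates of [psi] are still equal to [1] on [[-2, 2]]. *)
Lemma dyadic_low_eq0 j (xi : R) : (2 <= j)%N -> `|xi| <= 2 -> dyadic psi j xi = 0.
Proof.
case: j => [//|[//|i]] _ hx.
have [_ p1 _] := hpsi.
have e (m : nat) : `|2 ^- m.+1 * xi| <= 1.
  rewrite normrM gtr0_norm ?invr_gt0 ?exprn_gt0// mulrC ler_pdivrMr ?exprn_gt0// mul1r.
  by apply: le_trans hx _; rewrite exprS ler_peMr// exprn_ege1// ler1n.
apply: complex_eq.
  by rewrite Re_dyadicS /a !p1 ?e// subrr.
by rewrite Im_dyadicS /b !p1 ?e// subrr.
Qed.

Local Notation kernel j := (inv_fourier (dyadic psi j)).

Lemma kernel_rschwartz j : rschwartz (fun x => Re (kernel j x)) /\ rschwartz (fun x => Im (kernel j x)).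
Proof. by have [t1 t2] := dyadic_rtest j; exact: inv_fourier_rschwartz. Qed.

Definition generator_kernel (x : R) : R := Re (inv_fourier psi x).

Lemma generator_kernel_rschwartz : rschwartz generator_kernel.
Proof. by have [ta tb] := generator_rtest; have [] := inv_fourier_rschwartz ta tb. Qed.

(** Inversion at [0] gives a positive multiple of [Re (psi 0) = 1], the sine part being odd. *)
Lemma generator_kernel_integral_neq0 : \int[leb]_x generator_kernel x != 0.
Proof.
have [ta tb] := generator_rtest.
have E x : generator_kernel x = fourier_factor * (cosT a x - sinT b x).
  by rewrite /generator_kernel Re_inv_fourier//; exact: rtest_L1.
have i1 := rschwartz_L1 (cosT_rschwartz ta); have i2 := rschwartz_L1 (sinT_rschwartz tb).
under eq_Rintegral do rewrite E.
rewrite RintegralTZ; last exact: L1B.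
rewrite RintegralTB// cosT_inversion0// sinT_inversion0// subr0.
rewrite generator_eq1 ?normr0// mulr1 mulf_neq0// gt_eqF//.
  exact: fourier_factor_gt0.
exact: inversion_constant_gt0.
Qed.

Lemma Re_kernelS i (x : R) : Re (kernel i.+1 x) =
  2 ^+ i * (2 * generator_kernel (2 * (2 ^+ i * x)) - generator_kernel (2 ^+ i * x)).
Proof.
have [ta tb] := generator_rtest; have ia := rtest_L1 ta; have ib := rtest_L1 tb.
have [t1 t2] := dyadic_rtest i.+1.
rewrite Re_inv_fourier; [|exact: rtest_L1..].
have tas (m : nat) : L1 (fun xi => a (2 ^- m * xi)).
  by apply: rtest_L1; apply: rtest_scale => //; exact: two_expV_neq0.
have tbs (m : nat) : L1 (fun xi => b (2 ^- m * xi)).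
  by apply: rtest_L1; apply: rtest_scale => //; exact: two_expV_neq0.
have -> : cosT (fun xi => Re (dyadic psi i.+1 xi)) x =
    cosT (fun xi => a (2 ^- i.+1 * xi)) x - cosT (fun xi => a (2 ^- i * xi)) x.
  by rewrite -cosTB//; congr cosT; apply/funext => xi; exact: Re_dyadicS.
have -> : sinT (fun xi => Im (dyadic psi i.+1 xi)) x =
    sinT (fun xi => b (2 ^- i.+1 * xi)) x - sinT (fun xi => b (2 ^- i * xi)) x.
  by rewrite -sinTB//; congr sinT; apply/funext => xi; exact: Im_dyadicS.
have C (m : nat) : cosT (fun xi => a (2 ^- m * xi)) x = 2 ^+ m * cosT a (2 ^+ m * x).
  have := cosT_scale (2 ^+ m * x) (two_expV_neq0 m) ia.
  rewrite mulKf ?expf_neq0 ?pnatr_eq0// => ->.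
  by rewrite gtr0_norm ?invr_gt0 ?exprn_gt0// invrK.
have S (m : nat) : sinT (fun xi => b (2 ^- m * xi)) x = 2 ^+ m * sinT b (2 ^+ m * x).
  have := sinT_scale (2 ^+ m * x) (two_expV_neq0 m) ib.
  rewrite mulKf ?expf_neq0 ?pnatr_eq0// => ->.
  by rewrite gtr0_norm ?invr_gt0 ?exprn_gt0// invrK.
rewrite !C !S /generator_kernel !Re_inv_fourier//.
by rewrite exprS [2 * (2 ^+ i * x)]mulrA; ring.
Qed.

(* Odd, supported in [|xi| < 3 / 2] and such that [xi * witness_profile xi] is a
   square, so that its sine transform has a positive slope at [0]. *)
Definition witness_profile (xi : R) : R := (a xi * xi) * a xi.
Definition witness := sinT witness_profile.

Lemma witness_profile_rtest : rtest witness_profile.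
Proof.
have [ta _] := generator_rtest; apply: rtestM => //.
by apply: smoothM; [exact: ta.1|exact: smooth_id].
Qed.

Lemma witness_rschwartz : rschwartz witness.
Proof. exact: sinT_rschwartz witness_profile_rtest. Qed.

(** The frequencies of the witness satisfy [|eta| < 3 / 2], whereas this dyadic piece vanishes for
    [|eta| <= 2], so the spectra are disjoint. *)
Lemma convolution_witness j (x : R) : (2 <= j)%N ->
  convolution (kernel j) (regular_functional witness) x = 0.
Proof.
move=> j2; have [t1 t2] := dyadic_rtest j; have i1 := rtest_L1 t1; have i2 := rtest_L1 t2.
have tw := witness_profile_rtest.
have low eta : witness_profile eta != 0 -> dyadic psi j eta = 0 /\ dyadic psi j (- eta) = 0.
  move=> w0; have e2 : `|eta| <= 2.
    rewrite leNgt; apply/negP => eta2; move: w0; rewrite /witness_profile.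
    have [-> _] : a eta = 0 /\ b eta = 0 by apply: generator_eq0; lra.
    by rewrite mulr0 eqxx.
  by rewrite !dyadic_low_eq0// normrN.
apply: complex_eq.
  rewrite /convolution Re_regular_functional.
  under eq_Rintegral do rewrite Re_inv_fourier_trig//.
  apply: convolution_sinT_eq0 => //; [exact: rtestZ..|].
  by move=> eta /low[e1 e2]; rewrite e1 e2 !mulr0.
rewrite /convolution Im_regular_functional.
under eq_Rintegral do rewrite Im_inv_fourier_trig//.
apply: convolution_sinT_eq0 => //; [exact: rtestZ..|].
by move=> eta /low[e1 e2]; rewrite e1 e2 !mulr0.
Qed.

Lemma witness_besov (s p q alpha : R) : 1 <= p -> 1 <= q -> -1 < alpha ->
  besov psi s p q alpha (regular_functional witness).
Proof.
move=> p1 q1 al; have wi := rschwartz_L1 witness_rschwartz.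
split; first exact: tempered_regular_functional.
rewrite /besov_norm; apply: poweR_lty.
pose t (j : nat) := ((2 `^ (j%:R * s * q))%:E * weighted_Lp_norm p alpha
  (convolution (kernel j) (regular_functional witness)) `^ q)%E.
suff : (\sum_(0 <= j <oo) t j < +oo)%E by [].
have t0 j : (0 <= t j)%E by rewrite /t mule_ge0 ?poweR_ge0// lee_fin powR_ge0.
have tfin j : (t j < +oo)%E.
  have [k1 k2] := kernel_rschwartz j; have sw := witness_rschwartz.
  rewrite /t; apply: lte_mul_pinfty; rewrite ?lee_fin ?powR_ge0//.
  apply: poweR_lty; apply: weighted_Lp_norm_lty => //.
  - under eq_fun do rewrite /convolution Re_regular_functional.
    exact: (convolution_continuous sw k1).
  - under eq_fun do rewrite /convolution Im_regular_functional.
    exact: (convolution_continuous sw k2).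
  - under eq_fun do rewrite /convolution Re_regular_functional.
    exact: (convolution_rapid sw k1).
  - under eq_fun do rewrite /convolution Im_regular_functional.
    exact: (convolution_rapid sw k2).
(* Only the terms [j = 0] and [j = 1] survive, and each is finite. *)
rewrite (nneseries_split 0 2)// eseries0 ?adde0.
  rewrite add0n big_nat_recr//= big_nat1; exact: lte_add_pinfty.
move=> j j2 _; rewrite /t.
have -> : weighted_Lp_norm p alpha (convolution (kernel j) (regular_functional witness)) = 0%E.
  rewrite /weighted_Lp_norm integral0_eq ?poweR0r ?invr_eq0 ?gt_eqF//; first lra.
  move=> x _; rewrite convolution_witness// /= expr0n/= addr0 sqrtr0 powR0 ?mul0r//.
  by rewrite gt_eqF//; lra.
by rewrite poweR0r ?mule0// gt_eqF//; lra.
Qed.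

End generator.
End dyadic_kernels.

(** * Rescaling the convolutions of [|f|^mu] at the origin and passing to the limit *)

Section blow_up.
Context {R : realType}.
Local Notation leb := (@lebesgue_measure R).
Local Notation Re := complex.Re.
Local Notation Im := complex.Im.
Local Notation normc := Normc.normc.
Implicit Types f g h k : R -> R.

(** A nonzero value would persist on an interval of positive length. *)
Lemma ae_continuous_eq0 g : continuous g -> {ae leb, forall x, g x = 0} -> forall x, g x = 0.
Proof.
move=> cg ae0 x; apply/eqP; apply: contrapT => /negP gx.
have /cvgr_neq0/(_ gx) : g y @[y --> x] --> g x by exact: cg.
move=> /nbhs_ballP[e /= e0 he].
have neg : leb.-negligible `]x, (x + e)%R[%classic.
  apply: negligibleS ae0 => y /=; rewrite in_itv/= => /andP[xy ye] /= gy0.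
  have /he : ball x e y by rewrite /ball/= ltr_distlC; apply/andP; split; lra.
  by rewrite gy0 eqxx.
have mI : measurable (`]x, (x + e)%R[%classic : set (measurableTypeR R)).
  exact: measurable_itv.
have : leb `]x, (x + e)%R[%classic = 0%E by exact: measure_negligible mI neg.
rewrite lebesgue_measure_itv/= lte_fin ltrDl e0 -EFinB addrAC subrr add0r => /eqP.
by rewrite eqe gt_eqF.
Qed.

Lemma is_derive_lipschitz0 f (f' : R -> R) (C : R) (x : R) :
  (forall x, is_derive x (1 : R) f (f' x)) -> (forall x, `|f' x| <= C) -> f 0 = 0 ->
  `|f x| <= C * `|x|.
Proof.
move=> df fC f0; have cf : continuous f by move=> y; exact: is_derive_continuous (df y).
have [x0|x0] := leP 0 x.
  have [c _] := @MVT_segment _ f f' 0 x x0 (fun y _ => df y) (continuous_subspaceT cf).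
  by rewrite f0 !subr0 => ->; rewrite normrM ler_wpM2r.
have [c _] := @MVT_segment _ f f' x 0 (ltW x0) (fun y _ => df y) (continuous_subspaceT cf).
rewrite f0 !sub0r => /(congr1 Num.norm); rewrite normrN => ->.
by rewrite normrM normrN ler_wpM2r.
Qed.

(** This is [z] times the difference quotient at [0] with step [2^-i z]; the case [z = 0] is
    separate because the step has to be nonzero. *)
Lemma is_derive_dyadic_cvg f (d z : R) : is_derive 0 (1 : R) f d -> f 0 = 0 ->
  2 ^+ i * f (2 ^- i * z) @[i --> \oo] --> d * z.
Proof.
move=> df f0; have [->|z0] := eqVneq z 0.
  under eq_fun do rewrite mulr0 f0 mulr0.
  by rewrite mulr0; exact: cvg_cst.
have dv : derivable f 0 1 by exact: ex_derive.
have cv : h^-1 *: (f (h *: 1 + 0) - f 0) @[h --> 0^'] --> d.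
  by rewrite -(@derive_val _ _ _ _ _ _ _ df); exact: dv.
move/cvgr_dnbhsP : cv => /(_ (fun i => 2 ^- i * z)).
have u0 i : 2 ^- i * z != 0 by rewrite mulf_neq0// invr_eq0 expf_neq0// pnatr_eq0.
have ul : 2 ^- i * z @[i --> \oo] --> (0 : R).
  rewrite -[X in _ --> X](mul0r z); apply: cvgMl.
  under eq_fun do rewrite -exprVn.
  by apply: cvg_expr; rewrite ger0_norm// invf_lt1// ltr1n.
move=> /(_ (conj u0 ul)) cv.
have E i : z * ((2 ^- i * z)^-1 *: (f ((2 ^- i * z) *: 1 + 0) - f 0)) = 2 ^+ i * f (2 ^- i * z).
  rewrite /GRing.scale/= mulr1 addr0 f0 subr0 invfM invrK; set y := f _.
  by field.
have : z * ((2 ^- i * z)^-1 *: (f ((2 ^- i * z) *: 1 + 0) - f 0)) @[i --> \oo] --> z * d.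
  by apply: cvgMr; exact: cv.
by under eq_fun do rewrite E; rewrite mulrC.
Qed.

(** With [f] merely bounded, the translation is moved from [k] to [f], after which [B |k|] is a
    majorant independent of [x]. *)
Lemma bounded_convolution_continuous f k (B : R) : continuous f -> (forall x, `|f x| <= B) ->
  rschwartz k -> continuous (fun x => \int[leb]_y (f y * k (x - y))).
Proof.
move=> cf fB sk; have ck := rschwartz_continuous sk; have ki := rschwartz_L1 sk.
have E : (fun x => \int[leb]_y (f y * k (x - y))) = (fun x => \int[leb]_y (f (x - y) * k y)).
  apply/funext => x; have Li : L1 (fun y => f (x - y) * k y).
    apply: (@L1_bounded_mul _ _ _ B) => //.
    apply: continuous_measurable_fun; apply: cts_comp => //.
    by apply: ctsB; [exact: cts_cst|exact: cts_id].
  rewrite -(Rintegral_sub_var x Li); apply: eq_Rintegral => y _.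
  by rewrite subKr.
rewrite E; apply: (@continuous_Rintegral R (fun x y => f (x - y) * k y) (fun y => B * `|k y|)).
- move=> x; apply: continuous_measurable_fun; apply: ctsM => //.
  by apply: cts_comp => //; apply: ctsB; [exact: cts_cst|exact: cts_id].
- move=> y; apply: ctsM; last exact: cts_cst.
  by apply: cts_comp => //; apply: ctsB; [exact: cts_id|exact: cts_cst].
- by apply: L1Z; exact: L1_norm.
- by move=> x y; rewrite normrM ler_wpM2r.
Qed.

Context (psi : R -> R[i]) (hpsi : resolution_generator psi) (mu : R) (mu0 : 0 < mu).

Local Notation kernel j := (inv_fourier (dyadic psi j)).
Let f := witness psi.
Let F (x : R) : R := `|f x| `^ mu.
Let P := generator_kernel psi.
Let k (x : R) : R := 2 * P (2 * x) - P x.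

(** The derivative of the witness at [0], read off from its sine transform. *)
Definition witness_slope : R := \int[leb]_xi (xi * witness_profile psi xi).

(** The integrand is a continuous square with value [1] at [xi = 1], so its integral cannot be
    zero. *)
Lemma witness_slope_gt0 : 0 < witness_slope.
Proof.
have tw := rtest_mulx (witness_profile_rtest hpsi).
have ge0 xi : 0 <= xi * witness_profile psi xi.
  rewrite (_ : xi * _ = (Re (psi xi) * xi) ^+ 2) ?sqr_ge0//.
  by rewrite /witness_profile; ring.
have D0 : 0 <= witness_slope by apply: Rintegral_ge0 => xi _.
rewrite lt_neqAle D0 andbT; apply/eqP => /esym S0.
have wi := rtest_L1 tw.
have I0 : (\int[leb]_xi `|(xi * witness_profile psi xi)%:E| = 0)%E.
  under eq_integral do rewrite gee0_abs ?lee_fin//.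
  have := integrable_fin_num measurableT wi => fn.
  by rewrite -(fineK fn) -[X in X%:E]/witness_slope S0.
have mw : measurable_fun [set: measurableTypeR R] (EFin \o (fun xi => xi * witness_profile psi xi)).
  by apply/measurable_EFinP; exact: L1_measurable.
have ae0 := (ae_eq_integral_abs leb measurableT mw).1 I0.
have : forall x, x * witness_profile psi x = 0.
  apply: ae_continuous_eq0; first exact: smooth_continuous tw.1.
  by apply: filterS ae0 => x /(_ Logic.I)[].
move=> /(_ 1); rewrite mul1r /witness_profile (generator_eq1 hpsi) ?normr1//.
by rewrite !mulr1 => /eqP; rewrite oner_eq0.
Qed.

Lemma is_derive_witness (x : R) :
  is_derive x (1 : R) f (cosT (fun xi => xi * witness_profile psi xi) x).
Proof. exact: is_derive_sinT (witness_profile_rtest hpsi). Qed.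

Lemma witness0 : f 0 = 0.
Proof.
rewrite /f /witness /sinT; under eq_Rintegral do rewrite mul0r sin0 mul0r.
by rewrite Rintegral_cst// mul0r.
Qed.

Lemma witness_lipschitz : exists C : R, forall x, `|f x| <= C * `|x|.
Proof.
exists (\int[leb]_xi `|xi * witness_profile psi xi|) => x.
apply: (is_derive_lipschitz0 x is_derive_witness _ witness0) => y.
by apply: cosT_norm_le; apply: rtest_L1; apply: rtest_mulx; exact: witness_profile_rtest.
Qed.

Lemma witness_cvg (z : R) : 2 ^+ i * f (2 ^- i * z) @[i --> \oo] --> witness_slope * z.
Proof.
apply: is_derive_dyadic_cvg witness0; have := is_derive_witness 0.
congr is_derive; rewrite /cosT /witness_slope; apply: eq_Rintegral => xi _.
by rewrite mul0r cos0 mul1r.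
Qed.

Lemma witness_power_continuous : continuous F.
Proof.
apply: (cts_comp (f := fun w : R => `|w| `^ mu)); first exact: continuous_powR_norm.
exact: rschwartz_continuous (witness_rschwartz hpsi).
Qed.

Lemma witness_power_bounded : exists B : R, forall x, `|F x| <= B.
Proof.
have [B HB] := rapid_bounded (rschwartz_rapid (witness_rschwartz hpsi)).
exists (B `^ mu) => x; rewrite ger0_norm ?powR_ge0//.
by apply: ge0_ler_powR; rewrite ?nnegrE ?(ltW mu0)// (le_trans _ (HB x)).
Qed.

Lemma kernel_difference_rschwartz : rschwartz k.
Proof.
have two0 : (2 : R) != 0 by rewrite pnatr_eq0.
have sP := generator_kernel_rschwartz hpsi.
have := rschwartzD (rschwartzZ 2 (rschwartz_affine 0 two0 sP)) (rschwartzZ (-1) sP).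
by congr rschwartz; apply/funext => x; rewrite addr0 mulN1r.
Qed.

(** [F] seen at scale [2^-i] and renormalised for degree [mu]; it tends to
    [|witness_slope * w|^mu]. *)
Let Fi (i : nat) (w : R) : R := `|2 ^+ i * f (2 ^- i * w)| `^ mu.
Let gi (i : nat) (z : R) : R := \int[leb]_w (Fi i w * k (z - w)).

Lemma dilated_powerE i w : Fi i w = (2 ^+ i) `^ mu * F (2 ^- i * w).
Proof. by rewrite /Fi normrM powRM// ger0_norm ?exprn_ge0. Qed.

Lemma dilated_power_continuous i : continuous (Fi i).
Proof.
rewrite (_ : Fi i = fun w => (2 ^+ i) `^ mu * F (2 ^- i * w)); last first.
  by apply/funext => w; exact: dilated_powerE.
apply: ctsM; first exact: cts_cst.
apply: cts_comp; first exact: witness_power_continuous.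
by apply: ctsM; [exact: cts_cst|exact: cts_id].
Qed.

(** As the witness vanishes at [0] and is Lipschitz, its dilates are bounded by [C |w|] uniformly in
    [i]; this is the majorant for dominated convergence. *)
Lemma dilated_power_le : exists C : R, forall i w, `|Fi i w| <= C * `|w| `^ mu.
Proof.
have [C HC] := witness_lipschitz; have C0 : 0 <= C.
  by have := le_trans (normr_ge0 _) (HC 1); rewrite normr1 mulr1.
exists (C `^ mu) => i w; rewrite /Fi ger0_norm ?powR_ge0// -powRM//.
apply: ge0_ler_powR; [exact: ltW|by rewrite nnegrE|by rewrite nnegrE mulr_ge0|].
rewrite normrM; apply: (@le_trans _ _ (`|2 ^+ i| * (C * `|2 ^- i * w|))).
  by rewrite ler_wpM2l.
rewrite normrM [`|2 ^+ i|]ger0_norm ?exprn_ge0// [`|2 ^- i|]ger0_norm ?invr_ge0 ?exprn_ge0//.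
by rewrite mulrCA mulVKf// expf_neq0// pnatr_eq0.
Qed.

Lemma dilated_convolution_continuous i : continuous (gi i).
Proof.
have [B HB] := witness_power_bounded.
apply: (@bounded_convolution_continuous _ _ ((2 ^+ i) `^ mu * B)) kernel_difference_rschwartz.
  exact: dilated_power_continuous.
by move=> x; rewrite dilated_powerE normrM ger0_norm ?powR_ge0// ler_wpM2l ?powR_ge0.
Qed.

Lemma dilated_convolution_cvg z : gi i z @[i --> \oo] --> witness_slope `^ mu * homconv mu k z.
Proof.
have [C HC] := dilated_power_le; have sk := kernel_difference_rschwartz; have ck := rschwartz_continuous sk.
have Li := homconv_L1 mu0 z (rschwartz_rapid sk) ck.
have S0 := witness_slope_gt0.
rewrite -RintegralTZ//.
apply: (@L1_dominated R _ _ (fun w => C * `| `|w| `^ mu * k (z - w)|) _ _ _ _).2.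
- move=> i; apply: continuous_measurable_fun; apply: ctsM; first exact: dilated_power_continuous.
  by apply: cts_comp => //; apply: ctsB; [exact: cts_cst|exact: cts_id].
- by apply: L1Z; exact: L1_norm.
- by move=> i w; rewrite !normrM mulrA ler_wpM2r// (ger0_norm (powR_ge0 _ _)).
- move=> w; rewrite mulrA; apply: cvgMl.
  have -> : witness_slope `^ mu * `|w| `^ mu = `|witness_slope * w| `^ mu.
    by rewrite normrM powRM// ger0_norm// ltW.
  exact: (continuous_seq_cvg (continuous_powR_norm mu0) (@witness_cvg w)).
Qed.

(** Under [y = 2^-i w] the Jacobian cancels the factor [2^i] of the kernel, and only the
    renormalisation of [F] remains. *)
Lemma convolution_rescaled i (z : R) (v : (R -> R[i]) -> R[i]) :
  (forall x, Re (convolution (kernel i.+1) v x) = \int[leb]_y (F y * Re (kernel i.+1 (x - y)))) ->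
  Re (convolution (kernel i.+1) v (2 ^- i * z)) = ((2 ^+ i) `^ mu)^-1 * gi i z.
Proof.
move=> ->; have [k1 _] := kernel_rschwartz hpsi i.+1; have [B HB] := witness_power_bounded.
have c0 : (2 ^- i : R) != 0 by exact: two_expV_neq0.
have ck1 := rschwartz_L1 k1.
have Li : L1 (fun y => F y * Re (kernel i.+1 (2 ^- i * z - y))).
  apply: (L1_bounded_mul (B := B)) => //.
    by apply: continuous_measurable_fun; exact: witness_power_continuous.
  exact: (L1_sub_var (2 ^- i * z) ck1).
have Gi : L1 (fun w => Fi i w * k (z - w)).
  apply: (L1_bounded_mul (B := (2 ^+ i) `^ mu * B)).
  - by apply: continuous_measurable_fun; exact: dilated_power_continuous.
  - by move=> x; rewrite dilated_powerE normrM ger0_norm ?powR_ge0// ler_wpM2l ?powR_ge0.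
  - by apply: L1_sub_var; apply: rschwartz_L1; exact: kernel_difference_rschwartz.
rewrite (Rintegral_affine 0 c0 Li) /gi.
rewrite -RintegralTZ; last exact: (integrable_affine 0 c0 Li).
rewrite -RintegralTZ//; apply: eq_Rintegral => w _.
rewrite addr0 Re_kernelS// dilated_powerE -mulrBr mulVKf ?expf_neq0 ?pnatr_eq0//.
have p2 : (2 ^+ i : R) `^ mu != 0 by rewrite gt_eqF// powR_gt0// exprn_gt0.
rewrite ger0_norm ?invr_ge0 ?exprn_ge0// -/P -/(k (z - w)).
rewrite -[X in _ = _ * X]mulrA mulKf// mulrCA; congr (_ * _).
by rewrite mulKf// expf_neq0// pnatr_eq0.
Qed.

Context (p q alpha s : R).

Let I (i : nat) : \bar R := (\int[leb]_z (`|gi i z| `^ p * `|z| `^ alpha)%:E)%E.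
Let N (v : (R -> R[i]) -> R[i]) (j : nat) : \bar R :=
  (\int[leb]_x (normc (convolution (kernel j) v x) `^ p * `|x| `^ alpha)%:E)%E.

Lemma measurable_weighted (g : R -> R) : measurable_fun setT g ->
  measurable_fun setT (fun x => (`|g x| `^ p * `|x| `^ alpha)%:E).
Proof.
move=> mg; apply/measurable_EFinP; apply: measurable_funM.
  apply: (measurableT_comp (f := fun y => y `^ p)); first exact: measurable_powR.
  exact: measurableT_comp.
apply: (measurableT_comp (f := fun y => y `^ alpha)); first exact: measurable_powR.
exact: normr_measurable.
Qed.

(** In the exponent, [1] stems from the Jacobian of [x = 2^-i z], [mu * p] from the renormalisation
    in [convolution_rescaled], and [alpha] from the weight. The inequality itself is the passage
    from modulus to real part. *)
Lemma dilated_convolution_norm_le i (v : (R -> R[i]) -> R[i]) : 1 <= p ->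
  (forall j x, Re (convolution (kernel j) v x) = \int[leb]_y (F y * Re (kernel j (x - y)))) ->
  (forall j x, Im (convolution (kernel j) v x) = \int[leb]_y (F y * Im (kernel j (x - y)))) ->
  (I i <= (2 `^ (i%:R * (1 + mu * p + alpha)))%:E * N v i.+1)%E.
Proof.
move=> p1 vR vI; have [B HB] := witness_power_bounded.
have [k1 k2] := kernel_rschwartz hpsi i.+1.
pose G x := Re (convolution (kernel i.+1) v x).
have cR : continuous G.
  rewrite (_ : G = fun x => \int[leb]_y (F y * Re (kernel i.+1 (x - y)))).
    exact: (bounded_convolution_continuous witness_power_continuous HB k1).
  by apply/funext => x; exact: vR.
have cI : continuous (fun x => Im (convolution (kernel i.+1) v x)).
  rewrite (_ : (fun x => _) = fun x => \int[leb]_y (F y * Im (kernel i.+1 (x - y)))).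
    exact: (bounded_convolution_continuous witness_power_continuous HB k2).
  by apply/funext => x; exact: vI.
have mR := continuous_measurable_fun cR.
have c0 : (2 ^- i : R) != 0 by exact: two_expV_neq0.
have e2 (t : R) : 0 < 2 `^ t by exact: powR_gt0.
have step1 : ((\int[leb]_x (`|G x| `^ p * `|x| `^ alpha)%:E) <= N v i.+1)%E.
  apply: ge0_le_integral => //.
  - exact: (measurable_weighted mR).
  - rewrite (_ : (fun x => _) = (fun x => (`|normc (convolution (kernel i.+1) v x)| `^ p * `|x| `^ alpha)%:E)); last first.
      by apply/funext => x; rewrite [`|normc _|]ger0_norm ?normc_ge0.
    apply: measurable_weighted.
    rewrite (_ : (fun x => _) = (fun x => Num.sqrt (G x ^+ 2 + Im (convolution (kernel i.+1) v x) ^+ 2))); last first.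
      by apply/funext => x; rewrite /G; case: (convolution _ _ _).
    apply: continuous_measurable_fun; apply: cts_comp; first exact: sqrt_continuous.
    by apply: ctsD; apply: ctsM.
  - move=> x _; rewrite lee_fin ler_wpM2r ?powR_ge0//.
    by apply: ge0_ler_powR; rewrite ?nnegrE ?normc_ge0 ?Re_normc_le//; lra.
apply: (@le_trans _ _ ((2 `^ (i%:R * (1 + mu * p + alpha)))%:E * \int[leb]_x (`|G x| `^ p * `|x| `^ alpha)%:E)%E); last first.
  by apply: lee_wpmul2l => //; rewrite lee_fin ltW.
rewrite (ge0_integral_affine 0 c0 (measurable_weighted mR)); last first.
  by move=> x; rewrite lee_fin mulr_ge0 ?powR_ge0.
rewrite muleA -EFinM -ge0_integralZl_EFin//; last first.
  exact: (measurableT_comp (measurable_weighted mR) (measurable_affine _ _)).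
rewrite le_eqVlt; apply/orP; left; apply/eqP; apply: eq_integral => z _.
rewrite -EFinM addr0 /G (convolution_rescaled _ (vR i.+1)); congr EFin.
have i2 : 0 <= 2 ^- i :> R by rewrite invr_ge0 exprn_ge0.
have eI : 2 ^- i = 2 `^ (- i%:R) :> R by rewrite powR_invn.
have eM : ((2 ^+ i) `^ mu)^-1 = 2 `^ (- (i%:R * mu)) :> R.
  by rewrite powRN powRrM powR_mulrn.
rewrite !normrM (ger0_norm i2) eM (ger0_norm (ltW (e2 _))) !powRM ?powR_ge0//; last first.
rewrite eI -!powRrM [LHS]mulrC; set A := `|gi i z| `^ p; set Z := `|z| `^ alpha.
transitivity ((2 `^ (i%:R * (1 + mu * p + alpha)) * 2 `^ (- i%:R) * 2 `^ (- (i%:R * mu) * p) * 2 `^ (- i%:R * alpha)) * (A * Z)); last by ring.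
rewrite -!powRD ?pnatr_eq0 ?implybT// (_ : _ + _ = 0) ?powRr0 ?mul1r; first by rewrite mulrC.
ring.
Qed.

(** The term [t j] of the Besov sum is a [q]-th power and [N v j] a [p]-th power of the same norm,
    hence the exponent [p / q] used for comparison. *)
Lemma dilated_convolution_norm_cvg0 (v : (R -> R[i]) -> R[i]) : 1 <= p -> 1 <= q -> -1 < alpha -> 0 < s -> mu + (1 + alpha) / p <= s ->
  (forall j x, Re (convolution (kernel j) v x) = \int[leb]_y (F y * Re (kernel j (x - y)))) ->
  (forall j x, Im (convolution (kernel j) v x) = \int[leb]_y (F y * Im (kernel j (x - y)))) ->
  (besov_norm psi s p q alpha v < +oo)%E ->
  I i @[i --> \oo] --> (0 : \bar R)%E.
Proof.
move=> p1 q1 al s0 smu vR vI bn; have p0 : 0 < p by lra.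
have q0 : 0 < q by lra.
pose t (j : nat) := ((2 `^ (j%:R * s * q))%:E * weighted_Lp_norm p alpha
  (convolution (kernel j) v) `^ q)%E.
have t0 j : (0 <= t j)%E by rewrite /t mule_ge0 ?poweR_ge0// lee_fin powR_ge0.
have sumt : (\sum_(0 <= j <oo) t j < +oo)%E.
  by apply: (@lty_poweRy _ _ q^-1); [rewrite invr_eq0 gt_eqF|exact: bn].
have tt : t j @[j --> \oo] --> (0 : \bar R)%E.
  apply: (@squeeze_cvge _ _ _ _ (fun=> 0%E) _ (fun j => \sum_(j <= i <oo) t i)%E).
  (* Each term is at most the tail that it begins, and the tails of a finite nonnegative sum tend to
     zero. *)
  - apply: nearW => j; rewrite t0/= (nneseries_split j 1)// addn1 big_nat1.
    by apply: leeDl; apply: nneseries_ge0.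
  - exact: cvg_cst.
  - by have := nneseries_tail_cvg sumt (fun j _ => t0 j).
have tfin j : t j \is a fin_num.
  rewrite ge0_fin_numE//; apply: le_lt_trans sumt.
  rewrite (nneseries_split 0 j.+1)// add0n big_nat_recr//=.
  rewrite -addeA addeCA; apply: leeDl; apply: adde_ge0; last exact: nneseries_ge0.
  by apply: sume_ge0.
have Nt j : (t j `^ (p / q) = (2 `^ (j%:R * s * p))%:E * N v j)%E.
  rewrite /t poweRM ?lee_fin ?powR_ge0 ?poweR_ge0//.
  rewrite poweR_EFin -powRrM /weighted_Lp_norm -!poweRrM.
  rewrite (_ : p^-1 * (q * (p / q)) = 1); last by field; rewrite !gt_eqF.
  rewrite poweRe1; last by apply: integral_ge0 => x _; rewrite lee_fin mulr_ge0 ?powR_ge0.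
  by congr ((2 `^ _)%:E * _)%E; field; rewrite gt_eqF.
have It i : (I i <= t i.+1 `^ (p / q))%E.
  apply: le_trans (dilated_convolution_norm_le i p1 vR vI) _; rewrite Nt; apply: lee_wpmul2r.
    by apply: integral_ge0 => x _; rewrite lee_fin mulr_ge0 ?powR_ge0.
  rewrite lee_fin; apply: ler_powR; first by rewrite ler1n.
  (* The exponents compare as [i (1 + mu p + alpha) <= i s p <= (i + 1) s p]: the assumed lower
     bound on [s] gives the first inequality, and [s > 0] absorbs the index shift. *)
  have : mu * p + (1 + alpha) <= s * p.
    by rewrite -[1 + alpha](@divfK _ p) ?gt_eqF// -mulrDl ler_wpM2r// ltW.
  have := mulr_gt0 s0 p0; have : 0 <= (i%:R : R) by [].
  rewrite -natr1; move: (i%:R : R) => x x0 sp h; rewrite -mulrA.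
  apply: (@le_trans _ _ (x * (s * p))); last by rewrite ler_wpM2r// ?lerDl// ltW.
  by rewrite ler_wpM2l//; lra.
apply: (@squeeze_cvge _ _ _ _ (fun=> 0%E) _ (fun i => t i.+1 `^ (p / q))%E).
- apply: nearW => i; rewrite It andbT; apply: integral_ge0 => x _.
  by rewrite lee_fin mulr_ge0 ?powR_ge0.
- exact: cvg_cst.
have pq : 0 < p / q by rewrite divr_gt0.
have ft : fine (t i.+1) @[i --> \oo] --> (0 : R).
  by rewrite (cvg_shiftS (fun j => fine (t j))); exact: fine_cvg.
have := continuous_seq_cvg (continuous_powR_norm pq) ft.
rewrite normr0 powR0 ?gt_eqF// => ct.
rewrite (_ : (fun i => _) = (fun i => (`|fine (t i.+1)| `^ (p / q))%:E)).
  by apply: cvg_EFin; [exact: nearW|exact: ct].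
apply/funext => i; rewrite ger0_norm ?fine_ge0//.
by rewrite -poweR_EFin fineK.
Qed.

Lemma no_power_in_besov (v : (R -> R[i]) -> R[i]) : 1 <= p -> 1 <= q -> -1 < alpha -> 0 < s ->
  ~ (exists k : int, mu = (2 * k)%:~R) ->
  mu + (1 + alpha) / p <= s ->
  (forall j x, Re (convolution (kernel j) v x) = \int[leb]_y (F y * Re (kernel j (x - y)))) ->
  (forall j x, Im (convolution (kernel j) v x) = \int[leb]_y (F y * Im (kernel j (x - y)))) ->
  ~ (besov_norm psi s p q alpha v < +oo)%E.
Proof.
move=> p1 q1 al s0 hk smu vR vI bn; have p0 : 0 < p by lra.
have Ic := dilated_convolution_norm_cvg0 p1 q1 al s0 smu vR vI bn.
have sk := kernel_difference_rschwartz; have chk := homconv_continuous mu0 sk.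
pose g z := witness_slope `^ mu * homconv mu k z.
have cg : continuous g by apply: ctsM; [exact: cts_cst|exact: chk].
have mg : measurable_fun [set: measurableTypeR R] (fun z => (`|g z| `^ p * `|z| `^ alpha)%:E).
  by apply: measurable_weighted; exact: continuous_measurable_fun.
have J0 : (\int[leb]_z (`|g z| `^ p * `|z| `^ alpha)%:E <= 0)%E.
  have := @fatou _ _ R leb setT measurableT (fun i z => (`|gi i z| `^ p * `|z| `^ alpha)%:E).
  have -> : (limn_einf (fun i => \int[leb]_z (`|gi i z| `^ p * `|z| `^ alpha)%:E) = 0)%E.
    exact: (cvg_limn_einf_sup Ic).1.
  have lz (z : R) : limn_einf (fun i => (`|gi i z| `^ p * `|z| `^ alpha)%:E) =
      (`|g z| `^ p * `|z| `^ alpha)%:E.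
    have lc : (`|gi i z| `^ p * `|z| `^ alpha)%:E @[i --> \oo] --> (`|g z| `^ p * `|z| `^ alpha)%:E.
      apply: cvg_EFin; first exact: nearW.
      apply: cvgMl; exact: (continuous_seq_cvg (continuous_powR_norm p0) (@dilated_convolution_cvg z)).
    exact: (cvg_limn_einf_sup lc).1.
  under eq_integral do rewrite lz.
  apply.
  - by move=> i; apply: measurable_weighted; apply: continuous_measurable_fun; exact: dilated_convolution_continuous.
  - by move=> i z _; rewrite lee_fin mulr_ge0 ?powR_ge0.
have J1 : (\int[leb]_z `|(`|g z| `^ p * `|z| `^ alpha)%:E| = 0)%E.
  under eq_integral do rewrite gee0_abs ?lee_fin ?mulr_ge0 ?powR_ge0//.
  apply/eqP; rewrite eq_le J0/=; apply: integral_ge0 => z _.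
  by rewrite lee_fin mulr_ge0 ?powR_ge0.
have ae0 := (ae_eq_integral_abs leb measurableT mg).1 J1.
(* At [z = 0] the weight itself may be zero and say nothing about [g], so the origin is discarded as
   a null set. *)
have aez : {ae leb, forall z : R, z != 0}.
  exists [set 0]; split; [exact: measurable_set1|exact: lebesgue_measure_set1|].
  by move=> z /= /negP; rewrite negbK => /eqP.
have g0 : forall z, g z = 0.
  apply: ae_continuous_eq0 => //; apply: filterS2 ae0 aez => z /= /(_ Logic.I)[] /eqP + z0.
  rewrite mulf_eq0 => /orP[|]; rewrite powR_eq0 normr_eq0; last by rewrite (negbTE z0).
  by move=> /andP[/eqP].
have S0 : witness_slope `^ mu != 0 by rewrite gt_eqF// powR_gt0// witness_slope_gt0.
have h0 z : homconv mu k z = 0.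
  by apply/eqP; have /eqP := g0 z; rewrite mulf_eq0 (negbTE S0).
have := homconv_rigidity mu0 (generator_kernel_rschwartz hpsi) hk h0.
by apply/eqP; exact: generator_kernel_integral_neq0.
Qed.

End blow_up.

Theorem theorem1p4 (R : realType) (psi : R -> R[i]) (p q alpha mu s : R)
    (hpsi : resolution_generator psi)
    (hp : 1 <= p) (hq : 1 <= q) (halpha : -1 < alpha) (hmu : 0 < mu)
    (hs : Num.max 0 ((alpha + 1) / p - 1) < s)
    (hmu_even : ~ exists k : int, mu = (2 * k)%:~R)
    (hG : forall (u : (R -> R[i]) -> R[i]) (f : R -> R[i]),
       besov psi s p q alpha u -> regular_distribution u f ->
       exists v : (R -> R[i]) -> R[i],
         besov psi s p q alpha v /\ regular_distribution v (abs_power mu f)) :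
  s < mu + (1 + alpha) / p.
Proof.
rewrite ltNge; apply/negP => smu.
have s0 : 0 < s by move: hs; rewrite gt_max => /andP[].
have sw := witness_rschwartz hpsi.
have ub := witness_besov hpsi s hp hq halpha.
have [v [[tv nv] rv]] := hG _ _ ub (regular_functional_distribution (rschwartz_L1 sw)).
pose F x := `|witness psi x| `^ mu.
have {}rv : regular_distribution v (fun x => (F x)%:C%C).
  move: rv; congr regular_distribution; apply/funext => x.
  by rewrite /abs_power normc_real.
have [B HB] := witness_power_bounded hpsi hmu.
have mF := continuous_measurable_fun (witness_power_continuous hpsi hmu).
have vE j x : convolution (inv_fourier (dyadic psi j)) v x =
    regular_functional F (fun y => inv_fourier (dyadic psi j) (x - y)).
  have [k1 k2] := kernel_rschwartz hpsi j.
  have [ta _] := generator_rtest hpsi.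
  (* The real part of [psi], a test function equal to [1] on [[-1, 1]], serves as the cutoff. *)
  exact: (tempered_extension ta (generator_eq1 hpsi) tv rv mF HB (schwartz_reflect x k1 k2)).
apply: (no_power_in_besov hpsi hmu hp hq halpha s0 hmu_even smu _ _ nv) => j x.
  by rewrite vE Re_regular_functional.
by rewrite vE Im_regular_functional.
Qed.
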